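(* Let $X$ be a real Banach space, let $u\in S_X$ be a big point, and suppose there is a bicontractive linear projection $P: X\to[u]$ onto the span of $u$. Assume in addition that one of the following holds: (a) for every sequence $(x_n)\subset B_X$ with $\|u+x_n\|\to 2$ it holds that $P(x_n)\to u$ in norm; (b) the dual $X^*$ is $\omega^*$-LUR, i.e. for every $f\in S_{X^*}$ and every $(f_n)\subset B_{X^*}$ with $\|f+f_n\|\to 2$ one has $f_n\to f$ in the weak$^*$ topology. Then $X$ is isometrically a Hilbert space.
   Context: $\mathcal{G}_X$ is the group of surjective linear isometries of $X$ and $\mathcal{G}_X(x)=\{T(x):T\in\mathcal{G}_X\}$. A point $x\in S_X$ is a big point if $\overline{\mathrm{conv}}(\mathcal{G}_X(x))=B_X$. A linear projection $P$ is bicontractive if $\|P\|\le1$ and $\|I-P\|\le 1$. *)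

(* Defs.v *)
From Stdlib Require Import Reals.
Open Scope R_scope.

Record Banach := mkBanach {
  car :> Type;
  vzero : car;
  vadd : car -> car -> car;
  vopp : car -> car;
  vscal : R -> car -> car;
  vnorm : car -> R;
  vadd_assoc : forall x y z, vadd x (vadd y z) = vadd (vadd x y) z;
  vadd_comm : forall x y, vadd x y = vadd y x;
  vadd_0 : forall x, vadd x vzero = x;
  vadd_opp : forall x, vadd x (vopp x) = vzero;
  vscal_1 : forall x, vscal 1 x = x;
  vscal_assoc : forall a b x, vscal a (vscal b x) = vscal (a * b) x;
  vscal_distr_v : forall a x y, vscal a (vadd x y) = vadd (vscal a x) (vscal a y);
  vscal_distr_s : forall a b x, vscal (a + b) x = vadd (vscal a x) (vscal b x);
  vnorm_eq0 : forall x, vnorm x = 0 -> x = vzero;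
  vnorm_scal : forall a x, vnorm (vscal a x) = Rabs a * vnorm x;
  vnorm_triangle : forall x y, vnorm (vadd x y) <= vnorm x + vnorm y;
  complete : forall s : nat -> car,
    (forall eps, eps > 0 -> exists N, forall m n, (m >= N)%nat -> (n >= N)%nat ->
        vnorm (vadd (s m) (vopp (s n))) < eps) ->
    exists l, forall eps, eps > 0 -> exists N, forall n, (n >= N)%nat ->
        vnorm (vadd (s n) (vopp l)) < eps
}.

Arguments vzero {_}.
Arguments vadd {_}.
Arguments vopp {_}.
Arguments vscal {_}.
Arguments vnorm {_}.

Definition vsub {X : Banach} (x y : X) : X := vadd x (vopp y).

Definition sphere (X : Banach) (x : X) : Prop := vnorm x = 1.
Definition ball (X : Banach) (x : X) : Prop := vnorm x <= 1.

Definition linear_op {X : Banach} (T : X -> X) : Prop :=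
  (forall x y, T (vadd x y) = vadd (T x) (T y)) /\
  (forall a x, T (vscal a x) = vscal a (T x)).

Definition surj_lin_isometry {X : Banach} (T : X -> X) : Prop :=
  linear_op T /\ (forall x, vnorm (T x) = vnorm x) /\ (forall y, exists x, T x = y).

Definition orbit {X : Banach} (x : X) (y : X) : Prop :=
  exists T, surj_lin_isometry T /\ y = T x.

Fixpoint rsum (n : nat) (l : nat -> R) : R :=
  match n with O => 0 | S k => rsum k l + l k end.
Fixpoint vsum {X : Banach} (n : nat) (v : nat -> X) : X :=
  match n with O => vzero | S k => vadd (vsum k v) (v k) end.

Definition conv {X : Banach} (A : X -> Prop) (y : X) : Prop :=
  exists (n : nat) (l : nat -> R) (v : nat -> X),
    (forall i, (i < n)%nat -> 0 <= l i /\ A (v i)) /\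
    rsum n l = 1 /\ y = vsum n (fun i => vscal (l i) (v i)).

Definition closure {X : Banach} (A : X -> Prop) (y : X) : Prop :=
  forall eps, eps > 0 -> exists z, A z /\ vnorm (vsub y z) < eps.

Definition big_point {X : Banach} (x : X) : Prop :=
  sphere X x /\ (forall y, closure (conv (orbit x)) y <-> ball X y).

Definition projection_onto_span {X : Banach} (P : X -> X) (u : X) : Prop :=
  linear_op P /\ (forall x, P (P x) = P x) /\
  (forall y, (exists x, P x = y) <-> (exists t, y = vscal t u)).

Definition bicontractive {X : Banach} (P : X -> X) : Prop :=
  (forall x, vnorm (P x) <= vnorm x) /\ (forall x, vnorm (vsub x (P x)) <= vnorm x).

Definition cond_a {X : Banach} (u : X) (P : X -> X) : Prop :=
  forall xs : nat -> X, (forall n, ball X (xs n)) ->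
    Un_cv (fun n => vnorm (vadd u (xs n))) 2 ->
    Un_cv (fun n => vnorm (vsub (P (xs n)) u)) 0.

(** Dual space: linear functionals; bounded ones via the norm conditions below *)
Definition lin_functional {X : Banach} (f : X -> R) : Prop :=
  (forall x y, f (vadd x y) = f x + f y) /\ (forall a x, f (vscal a x) = a * f x).

Definition dual_norm_is {X : Banach} (f : X -> R) (r : R) : Prop :=
  is_lub (fun s => exists x, ball X x /\ s = Rabs (f x)) r.

Definition dual_sphere {X : Banach} (f : X -> R) : Prop :=
  lin_functional f /\ dual_norm_is f 1.

Definition dual_ball {X : Banach} (f : X -> R) : Prop :=
  lin_functional f /\ (forall x, Rabs (f x) <= vnorm x).

Definition dual_wstar_LUR (X : Banach) : Prop :=
  forall (f : X -> R) (fs : nat -> X -> R),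
    dual_sphere f -> (forall n, dual_ball (fs n)) ->
    (forall a : nat -> R, (forall n, dual_norm_is (fun x => f x + fs n x) (a n)) ->
       Un_cv a 2 -> forall x, Un_cv (fun n => fs n x) (f x)).

Definition is_hilbert (X : Banach) : Prop :=
  exists ip : X -> X -> R,
    (forall x y z, ip (vadd x y) z = ip x z + ip y z) /\
    (forall a x y, ip (vscal a x) y = a * ip x y) /\
    (forall x y, ip x y = ip y x) /\
    (forall x, 0 <= ip x x) /\
    (forall x, vnorm x = sqrt (ip x x)).

(* Main.v *)
Require Import Defs.
From Stdlib Require Import Reals ZArith Lra Lia Psatz List Classical ClassicalEpsilon.
From Stdlib Require Import FunctionalExtensionality ProofIrrelevance.
From mathcomp Require classical_sets.
Open Scope R_scope.

(** Write [P x = f(x) u], and [f_v = f o T^-1] for a point [v = T u] of the orbit.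

    If a space is strictly convex and each unit vector [x] carries a
    bicontractive projection onto its line, the corresponding orthogonality
    relation is symmetric.  In dimension at least three, comparing collinear
    triples as in the fundamental theorem of projective geometry makes the
    duality map additive along orthogonal frames, so that the norm is
    Euclidean.  In dimension two one uses instead an almost maximal inscribed
    quadratic form, which is almost invariant under isometries, together with a
    dense orbit.

    Under (b) this applies to [X^*]: it is strictly convex, and if [g(v_n) -> 1]
    with [v_n] in the orbit, then [f_{v_n} -> g] pointwise, so the adjoint
    projections [h |-> h(v_n) f_{v_n}] converge to one onto the line of [g].
    Hence [X^*], and then [X], satisfies the parallelogram inequality; the orbit
    is dense in the sphere and the same criterion applies to [X].

    Under (a), if [f_v(w)] and [f_w(v)] are close to 1, alternating the two
    contractions [x |-> x - f_v(x) v] and [x |-> x - f_w(x) w] shows that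
    [||f_w - f_v|| ||w - v||] is small.  So either [f(v) -> 1] forces [v -> u]
    along the orbit, in which case [X] is strictly convex with a dense orbit, or
    it forces [f_v -> f] in norm, which implies (b). *)

(** A symmetric orthogonality relation cannot by itself force a plane to be Euclidean: every Radon
    plane, Euclidean or not, has a bicontractive projection onto each of its lines. Hence dimension
    two has to use the isometries, while in higher dimension a vector orthogonal to two given ones
    supplies the missing rigidity.

    The functionals are chosen point by point, so nothing about homogeneity or continuity in the
    base point is known in advance. Homogeneity comes from symmetry of orthogonality, linearity from
    a local bound on an additive function, and subgradient inequalities stand in for derivatives of
    the norm.

    Limits of projections are taken under lower semicontinuity of [||y - s v_n||] instead of
    convergence of [v_n], because in the dual the orbit functionals converge only pointwise. The
    limit functional is identified in advance: its value at [y] must be the coordinate of the point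
    of the line nearest to [y], unique by strict convexity. *)

Notation "x +v y" := (vadd x y) (at level 50, left associativity).
Notation "x -v y" := (vsub x y) (at level 50, left associativity).
Notation "a *v x" := (vscal a x) (at level 40, left associativity).

(** * Deciding linear identities between vectors *)

Inductive vexpr :=
  | VVar (n : nat)
  | VZero
  | VAdd (e1 e2 : vexpr)
  | VSub (e1 e2 : vexpr)
  | VOpp (e : vexpr)
  | VScal (a : R) (e : vexpr).

Fixpoint veval {X : Banach} (l : list X) (e : vexpr) : X :=
  match e with
  | VVar n => nth n l vzero
  | VZero => vzero
  | VAdd e1 e2 => veval l e1 +v veval l e2
  | VSub e1 e2 => veval l e1 -v veval l e2
  | VOpp e => vopp (veval l e)
  | VScal a e => a *v veval l e
  end.

Fixpoint vcoef (e : vexpr) (n : nat) : R :=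
  match e with
  | VVar m => if Nat.eqb m n then 1 else 0
  | VZero => 0
  | VAdd e1 e2 => vcoef e1 n + vcoef e2 n
  | VSub e1 e2 => vcoef e1 n - vcoef e2 n
  | VOpp e => - vcoef e n
  | VScal a e => a * vcoef e n
  end.

Fixpoint lincomb {X : Banach} (l : list X) (c : nat -> R) : X :=
  match l with
  | nil => vzero
  | x :: l => c 0%nat *v x +v lincomb l (fun n => c (S n))
  end.

(** Recursion over the atoms turns equality of coefficients into finitely many scalar goals. [k] is
    the index of the first remaining atom, so that [c] and [d] are never shifted. *)
Fixpoint eqcoefs {X : Banach} (l : list X) (k : nat) (c d : nat -> R) : Prop :=
  match l with
  | nil => True
  | _ :: l => c k = d k /\ eqcoefs l (S k) c d
  end.

Lemma vscal_0 {X : Banach} (x : X) : 0 *v x = vzero.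
Proof.
  assert (H : 0 *v x +v 0 *v x = 0 *v x).
  { rewrite <- vscal_distr_s. f_equal. ring. }
  rewrite <- (vadd_opp _ (0 *v x)). rewrite <- H at 2.
  rewrite <- vadd_assoc, vadd_opp, vadd_0. reflexivity.
Qed.

Lemma vscal_zero {X : Banach} (a : R) : a *v (@vzero X) = vzero.
Proof.
  rewrite <- (vscal_0 (@vzero X)), vscal_assoc. f_equal. ring.
Qed.

Lemma vopp_scal {X : Banach} (x : X) : vopp x = (-1) *v x.
Proof.
  assert (H : x +v (-1) *v x = vzero).
  { rewrite <- (vscal_1 _ x) at 1. rewrite <- vscal_distr_s, <- (vscal_0 x).
    f_equal. ring. }
  rewrite <- (vadd_0 _ (vopp x)), <- H, vadd_assoc, (vadd_comm _ (vopp x)).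
  rewrite vadd_opp, vadd_comm, vadd_0. reflexivity.
Qed.

Lemma lincomb_ext {X : Banach} (l : list X) c d :
  (forall n, c n = d n) -> lincomb l c = lincomb l d.
Proof.
  revert c d; induction l as [|x l IH]; intros c d H; simpl; trivial.
  rewrite H, (IH _ (fun n => d (S n))); auto.
Qed.

Lemma lincomb_zero {X : Banach} (l : list X) : lincomb l (fun _ => 0) = vzero.
Proof.
  induction l as [|x l IH]; simpl; trivial.
  rewrite IH, vscal_0, vadd_0. reflexivity.
Qed.

Lemma lincomb_add {X : Banach} (l : list X) c d :
  lincomb l (fun n => c n + d n) = lincomb l c +v lincomb l d.
Proof.
  revert c d; induction l as [|x l IH]; intros c d; simpl.
  - rewrite vadd_0; reflexivity.
  - rewrite (IH (fun n => c (S n)) (fun n => d (S n))), vscal_distr_s.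
    rewrite !vadd_assoc. f_equal.
    rewrite <- !vadd_assoc. f_equal. apply vadd_comm.
Qed.

Lemma lincomb_scal {X : Banach} (l : list X) a c :
  lincomb l (fun n => a * c n) = a *v lincomb l c.
Proof.
  revert c; induction l as [|x l IH]; intros c; simpl.
  - symmetry; apply vscal_zero.
  - rewrite (IH (fun n => c (S n))), vscal_distr_v, vscal_assoc. reflexivity.
Qed.

Lemma lincomb_nth {X : Banach} (l : list X) m :
  lincomb l (fun n => if Nat.eqb m n then 1 else 0) = nth m l vzero.
Proof.
  revert m; induction l as [|x l IH]; intros [|m]; simpl; trivial.
  - rewrite lincomb_zero, vscal_1, vadd_0; reflexivity.
  - rewrite IH, vscal_0, vadd_comm, vadd_0; reflexivity.
Qed.

Lemma veval_lincomb {X : Banach} (l : list X) e : veval l e = lincomb l (vcoef e).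
Proof.
  induction e as [m| |e1 IH1 e2 IH2|e1 IH1 e2 IH2|e IH|a e IH]; simpl.
  - symmetry; apply lincomb_nth.
  - symmetry; apply lincomb_zero.
  - rewrite IH1, IH2. symmetry; apply lincomb_add.
  - rewrite IH1, IH2. unfold vsub. rewrite vopp_scal, <- lincomb_scal, <- lincomb_add.
    apply lincomb_ext; intros n; ring.
  - rewrite IH, vopp_scal, <- lincomb_scal. apply lincomb_ext; intros n; ring.
  - rewrite IH. symmetry; apply lincomb_scal.
Qed.

Lemma lincomb_eqcoefs {X : Banach} (l : list X) k c d :
  eqcoefs l k c d ->
  lincomb l (fun n => c (k + n)%nat) = lincomb l (fun n => d (k + n)%nat).
Proof.
  revert k; induction l as [|x l IH]; intros k; simpl; trivial.
  rewrite Nat.add_0_r; intros [-> H]; f_equal.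
  rewrite (lincomb_ext l _ (fun n => c (S k + n)%nat)) by (intros; f_equal; lia).
  rewrite (IH _ H). apply lincomb_ext; intros; f_equal; lia.
Qed.

Lemma veval_eq {X : Banach} (l : list X) e1 e2 :
  eqcoefs l 0 (vcoef e1) (vcoef e2) -> veval l e1 = veval l e2.
Proof.
  intros H. rewrite !veval_lincomb. exact (lincomb_eqcoefs l 0 _ _ H).
Qed.

Ltac vmem x l :=
  lazymatch l with
  | nil => constr:(false)
  | x :: _ => constr:(true)
  | _ :: ?l => vmem x l
  end.
Ltac vindex x l :=
  lazymatch l with
  | x :: _ => constr:(0%nat)
  | _ :: ?l => let n := vindex x l in constr:(S n)
  end.
Ltac vatoms l e :=
  lazymatch e with
  | vzero => l
  | vadd ?a ?b => let l := vatoms l a in vatoms l b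
  | vsub ?a ?b => let l := vatoms l a in vatoms l b
  | vopp ?a => vatoms l a
  | vscal _ ?a => vatoms l a
  | _ => lazymatch vmem e l with true => l | false => constr:(e :: l) end
  end.
Ltac vreify l e :=
  lazymatch e with
  | vzero => constr:(VZero)
  | vadd ?a ?b => let x := vreify l a in let y := vreify l b in constr:(VAdd x y)
  | vsub ?a ?b => let x := vreify l a in let y := vreify l b in constr:(VSub x y)
  | vopp ?a => let x := vreify l a in constr:(VOpp x)
  | vscal ?r ?a => let x := vreify l a in constr:(VScal r x)
  | _ => let n := vindex e l in constr:(VVar n)
  end.
(* Reduces an identity between vectors to the identities between the
   coefficients of each atom. *)
Ltac vec_coefs :=
  lazymatch goal with
  | |- @eq ?T ?a ?b =>
    let l := vatoms (@nil T) a in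
    let l := vatoms l b in
    let x := vreify l a in
    let y := vreify l b in
    change (veval l x = veval l y);
    apply veval_eq; cbn [eqcoefs vcoef Nat.eqb]; repeat split
  end.
Ltac vec := vec_coefs; try ring; try (field; auto; fail); try lra.

(** * Elementary facts on norms and linear functionals *)

Lemma Rabs_le_inv a b : Rabs a <= b -> - b <= a <= b.
Proof. unfold Rabs. destruct (Rcase_abs a); lra. Qed.

Lemma norm_zero {X : Banach} : vnorm (@vzero X) = 0.
Proof.
  rewrite <- (vscal_0 (@vzero X)), vnorm_scal, Rabs_R0. ring.
Qed.

Lemma norm_opp {X : Banach} (x : X) : vnorm (vopp x) = vnorm x.
Proof.
  rewrite vopp_scal, vnorm_scal, Rabs_left; lra.
Qed.

Lemma norm_ge0 {X : Banach} (x : X) : 0 <= vnorm x.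
Proof.
  pose proof (vnorm_triangle X x (vopp x)) as H.
  rewrite vadd_opp, norm_zero, norm_opp in H. lra.
Qed.

Lemma norm_pos {X : Banach} (x : X) : x <> vzero -> 0 < vnorm x.
Proof.
  intros H. destruct (norm_ge0 x) as [H0|H0]; trivial.
  destruct H; apply vnorm_eq0; auto.
Qed.

Lemma norm_sub_sym {X : Banach} (x y : X) : vnorm (x -v y) = vnorm (y -v x).
Proof.
  rewrite <- norm_opp. f_equal. vec.
Qed.

Lemma norm_le_add {X : Banach} (x y z : X) : x = y +v z -> vnorm x <= vnorm y + vnorm z.
Proof.
  intros ->. apply vnorm_triangle.
Qed.

Lemma norm_sub_le {X : Banach} (x y : X) : vnorm (x -v y) <= vnorm x + vnorm y.
Proof.
  rewrite <- (norm_opp y). apply vnorm_triangle.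
Qed.

Lemma vsub_eq0 {X : Banach} (x y : X) : x -v y = vzero -> x = y.
Proof.
  intros H. replace x with (x -v y +v y) by vec. rewrite H. vec.
Qed.

Lemma vscal_eq0 {X : Banach} (a : R) (x : X) : a *v x = vzero -> x <> vzero -> a = 0.
Proof.
  intros H Hx. apply NNPP; intros Ha. apply Hx.
  replace x with ((/ a) *v (a *v x)) by vec.
  rewrite H. apply vscal_zero.
Qed.

Lemma norm_normalize {X : Banach} (x : X) : x <> vzero -> vnorm ((/ vnorm x) *v x) = 1.
Proof.
  intros H. apply norm_pos in H.
  rewrite vnorm_scal, Rabs_right; [field; lra|].
  apply Rle_ge, Rlt_le, Rinv_0_lt_compat; trivial.
Qed.

Lemma lin_add {X : Banach} (f : X -> R) (x y : X) :
  lin_functional f -> f (x +v y) = f x + f y.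
Proof. intros [H _]; apply H. Qed.

Lemma lin_scal {X : Banach} (f : X -> R) a (x : X) :
  lin_functional f -> f (a *v x) = a * f x.
Proof. intros [_ H]; apply H. Qed.

Lemma lin_opp {X : Banach} (f : X -> R) (x : X) :
  lin_functional f -> f (vopp x) = - f x.
Proof. intros H. rewrite vopp_scal, lin_scal by trivial. ring. Qed.

Lemma lin_sub {X : Banach} (f : X -> R) (x y : X) :
  lin_functional f -> f (x -v y) = f x - f y.
Proof. intros H. unfold vsub. rewrite lin_add, lin_opp by trivial. ring. Qed.

Lemma lin_zero {X : Banach} (f : X -> R) :
  lin_functional f -> f vzero = 0.
Proof. intros H. rewrite <- (vscal_0 vzero), lin_scal by trivial. ring. Qed.

Ltac lin H :=
  repeat first [rewrite (lin_add _ _ _ H) | rewrite (lin_sub _ _ _ H)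
    | rewrite (lin_scal _ _ _ H) | rewrite (lin_opp _ _ H) | rewrite (lin_zero _ H)].

Lemma dual_ball_le {X : Banach} (f : X -> R) x : dual_ball f -> f x <= vnorm x.
Proof.
  intros [_ H]. specialize (H x). apply Rabs_le_inv in H. lra.
Qed.

Lemma dual_norm_is_bound {X : Banach} (f : X -> R) r :
  lin_functional f -> dual_norm_is f r -> forall x, Rabs (f x) <= r * vnorm x.
Proof.
  intros Lf [H _] x. destruct (classic (x = vzero)) as [->|Hx].
  { rewrite (lin_zero _ Lf), norm_zero, Rabs_R0. lra. }
  assert (K : Rabs (f (/ vnorm x *v x)) <= r).
  { apply H. eexists; split; [|reflexivity]. right. apply norm_normalize; trivial. }
  apply norm_pos in Hx.
  rewrite (lin_scal _ _ _ Lf), Rabs_mult, Rabs_right in K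
    by (apply Rle_ge, Rlt_le, Rinv_0_lt_compat; trivial).
  apply (Rmult_le_compat_l (vnorm x)) in K; [|lra].
  replace (vnorm x * (/ vnorm x * Rabs (f x))) with (Rabs (f x)) in K by (field; lra). lra.
Qed.

(** * Bicontractive functionals and strict convexity *)

Definition bicontractive_at {X : Banach} (x : X) (f : X -> R) : Prop :=
  dual_ball f /\ f x = 1 /\ forall y, vnorm (y -v f y *v x) <= vnorm y.

Definition strictly_convex (X : Banach) : Prop :=
  forall x y : X, vnorm x = 1 -> vnorm y = 1 -> vnorm (x +v y) = 2 -> x = y.

Lemma strictly_convex_eq {X : Banach} (x y : X) :
  strictly_convex X -> vnorm x = vnorm y -> 2 * vnorm x <= vnorm (x +v y) -> x = y.
Proof.
  intros SC Hxy H.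
  destruct (classic (x = vzero)) as [Hx|Hx].
  - rewrite Hx, norm_zero in Hxy. rewrite Hx. symmetry; apply vnorm_eq0; auto.
  - assert (Hp := norm_pos x Hx). set (n := vnorm x) in *.
    assert (E : / n *v x = / n *v y).
    { apply SC; rewrite ?vnorm_scal, ?Rabs_right; fold n;
        try (apply Rle_ge, Rlt_le, Rinv_0_lt_compat; trivial).
      - field; lra.
      - rewrite <- Hxy. field; lra.
      - replace (/ n *v x +v / n *v y) with (/ n *v (x +v y)) by vec.
        rewrite vnorm_scal, Rabs_right
          by (apply Rle_ge, Rlt_le, Rinv_0_lt_compat; trivial).
        assert (vnorm (x +v y) = 2 * n) as ->; [|field; lra].
        pose proof (vnorm_triangle X x y) as T. fold n in T. lra. }
    replace x with (n *v (/ n *v x)) by (vec; field; lra).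
    rewrite E. vec. field; lra.
Qed.

(** Both [x] and [x + s y] minimise the norm on the same line; their midpoint is no shorter, so
    strict convexity identifies them. *)
Lemma strictly_convex_min_unique {X : Banach} (x y : X) s :
  strictly_convex X ->
  (forall t, vnorm x <= vnorm (x +v t *v y)) ->
  (forall t, vnorm (x +v s *v y) <= vnorm (x +v s *v y +v t *v y)) ->
  s *v y = vzero.
Proof.
  intros SC H1 H2.
  assert (E : vnorm x = vnorm (x +v s *v y)).
  { apply Rle_antisym; trivial. specialize (H2 (- s)).
    replace (x +v s *v y +v (- s) *v y) with x in H2 by vec. trivial. }
  assert (E2 : x = x +v s *v y).
  { apply strictly_convex_eq; trivial.
    replace (x +v (x +v s *v y)) with (2 *v (x +v (s / 2) *v y)) by (vec; field).
    rewrite vnorm_scal, Rabs_right by lra. specialize (H1 (s / 2)). lra. }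
  replace (s *v y) with (x +v s *v y -v x) by vec.
  rewrite <- E2. vec.
Qed.

(** * Orthogonality forms *)

(* [B x] is [||x||] times the coefficient functional of a bicontractive
   projection onto the line of [x]. *)
Definition orthogonality_form {X : Banach} (B : X -> X -> R) : Prop :=
  (forall x, lin_functional (B x)) /\
  (forall x, B x x = vnorm x ^ 2) /\
  (forall x y, Rabs (B x y) <= vnorm x * vnorm y) /\
  (forall x y, B x y = 0 -> forall t, vnorm y <= vnorm (y +v t *v x)).

(** The last clause of the form comes from the complementary projection: when the functional of [x]
    kills [y], that contraction sends [y + t x] to [y]. *)
Lemma orthogonality_form_exists {X : Banach} :
  (forall x : X, vnorm x = 1 -> exists f, bicontractive_at x f) ->
  exists B : X -> X -> R, orthogonality_form B.
Proof.
  intros H.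
  assert (H' : forall x : X, exists f, vnorm x = 1 -> bicontractive_at x f).
  { intros x. destruct (classic (vnorm x = 1)) as [E|E].
    - destruct (H x E) as [f Hf]. exists f; auto.
    - exists (fun _ => 0). intros; contradiction. }
  set (F := fun x : X => proj1_sig (constructive_indefinite_description _ (H' x))).
  assert (HF : forall x : X, x <> vzero -> bicontractive_at (/ vnorm x *v x) (F (/ vnorm x *v x))).
  { intros x Hx. unfold F. destruct constructive_indefinite_description as [f Hf]; simpl.
    apply Hf, norm_normalize, Hx. }
  clearbody F.
  exists (fun x y => vnorm x * F (/ vnorm x *v x) y).
  assert (D : forall x : X, vnorm x = 0 \/ (0 < vnorm x /\
    bicontractive_at (/ vnorm x *v x) (F (/ vnorm x *v x)))).
  { intros x. destruct (classic (x = vzero)) as [->|Hx].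
    - left; apply norm_zero.
    - right; auto using norm_pos. }
  split; [|split; [|split]].
  - intros x. split; intros; (destruct (D x) as [-> |[Hp [[L _] _]]]; [ring|lin L; ring]).
  - intros x. destruct (D x) as [-> |[Hp [[L _] [E _]]]]; [ring|].
    revert E. lin L. intros E.
    replace (F (/ vnorm x *v x) x) with (vnorm x); [ring|].
    apply (Rmult_eq_reg_l (/ vnorm x)); [rewrite E; field; lra|].
    apply Rinv_neq_0_compat; lra.
  - intros x y. rewrite Rabs_mult, (Rabs_right (vnorm x)) by apply Rle_ge, norm_ge0.
    destruct (D x) as [-> |[Hp [[_ L] _]]]; [lra|].
    apply Rmult_le_compat_l; [lra|apply L].
  - intros x y E t. destruct (D x) as [E0 |[Hp [[L _] [E1 C]]]].
    + apply vnorm_eq0 in E0. rewrite E0. right; f_equal. rewrite vscal_zero, vadd_0; trivial.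
    + specialize (C (y +v t *v x)). revert C E1. lin L.
      apply Rmult_integral in E as [E|E]; [lra|].
      rewrite E. intros C E1.
      assert (E2 : F (/ vnorm x *v x) x = vnorm x).
      { apply (Rmult_eq_reg_l (/ vnorm x)); [rewrite E1; field; lra|].
        apply Rinv_neq_0_compat; lra. }
      rewrite E2 in C.
      replace (y +v t *v x -v (0 + t * vnorm x) *v (/ vnorm x *v x)) with y in C
        by (vec; field; lra).
      trivial.
Qed.

Section FormProperties.
Context {X : Banach} (B : X -> X -> R) (HB : orthogonality_form B)
  (SC : strictly_convex X).

Let Blin x : lin_functional (B x) := proj1 HB x.
Let Bself x : B x x = vnorm x ^ 2 := proj1 (proj2 HB) x.
Let Babs x y : Rabs (B x y) <= vnorm x * vnorm y := proj1 (proj2 (proj2 HB)) x y.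

Lemma form_zero_l (y : X) : B vzero y = 0.
Proof.
  pose proof (Babs vzero y) as H.
  rewrite norm_zero in H.
  apply Rabs_le_inv in H. lra.
Qed.

Lemma form_le (x y : X) : B x y <= vnorm x * vnorm y.
Proof.
  pose proof (Babs x y) as H. apply Rabs_le_inv in H. lra.
Qed.

Lemma form_min_r (x y : X) : B x y = 0 -> forall t, vnorm y <= vnorm (y +v t *v x).
Proof. apply HB. Qed.

Lemma form_min_l (x y : X) : B x y = 0 -> forall t, vnorm x <= vnorm (x +v t *v y).
Proof.
  intros E t. destruct (classic (x = vzero)) as [->|Hx].
  { rewrite norm_zero. apply norm_ge0. }
  apply norm_pos in Hx. pose proof (form_le x (x +v t *v y)) as H.
  revert H. lin (Blin x). rewrite E, Bself. intros H. nra.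
Qed.

(** Orthogonality makes [x] shortest on its line in direction [y]. The point [x + s y] on which the
    functional of [y] vanishes is shortest on that line too, for the other reason ([form_min_r]). By
    uniqueness [s = 0]. *)
Lemma form_sym0 (x y : X) : B x y = 0 -> B y x = 0.
Proof.
  intros E. destruct (classic (y = vzero)) as [->|Hy]; [apply form_zero_l|].
  pose proof (norm_pos y Hy) as Hp.
  set (s := - (B y x / vnorm y ^ 2)).
  assert (Es : s *v y = vzero).
  { apply (strictly_convex_min_unique x y s SC (form_min_l x y E)).
    apply form_min_r. lin (Blin y). rewrite Bself. unfold s. field. lra. }
  apply vscal_eq0 in Es; trivial. unfold s in Es.
  replace (B y x) with (- (- (B y x / vnorm y ^ 2)) * vnorm y ^ 2) by (field; lra).
  rewrite Es. ring.
Qed.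

(** The functionals at [x] and at [c x] were chosen independently. Their kernels agree because
    symmetry moves the factor [c] into the linear slot and back. *)
Lemma form_scal_l (c : R) (x y : X) : B (c *v x) y = c * B x y.
Proof.
  destruct (classic (x = vzero)) as [->|Hx].
  { rewrite vscal_zero, form_zero_l. ring. }
  pose proof (norm_pos x Hx) as Hp.
  set (s := B x y / vnorm x ^ 2).
  assert (E : B x (y -v s *v x) = 0).
  { lin (Blin x). rewrite Bself. unfold s. field. lra. }
  apply form_sym0 in E.
  assert (E' : B (y -v s *v x) (c *v x) = 0) by (lin (Blin (y -v s *v x)); rewrite E; ring).
  apply form_sym0 in E'. revert E'. lin (Blin (c *v x)).
  destruct (Req_dec c 0) as [->|Hc].
  { intros _. rewrite vscal_0, form_zero_l. ring. }
  assert (Ex : B (c *v x) x = c * vnorm x ^ 2).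
  { apply (Rmult_eq_reg_l c); trivial. rewrite <- (lin_scal _ c x (Blin _)), Bself.
    rewrite vnorm_scal, Rpow_mult_distr, pow2_abs. ring. }
  rewrite Ex. unfold s. intros E'.
  replace (c * B x y) with (B x y / vnorm x ^ 2 * (c * vnorm x ^ 2)) by (field; lra).
  lra.
Qed.

(** A substitute for additivity in the first slot: the functional of a sum vanishes on the common
    kernel, since symmetry moves the sum into the linear slot. *)
Lemma form_ker_add (p q k : X) : B p k = 0 -> B q k = 0 -> B (p +v q) k = 0.
Proof.
  intros Hp Hq. apply form_sym0. lin (Blin k).
  rewrite (form_sym0 _ _ Hp), (form_sym0 _ _ Hq). ring.
Qed.

Lemma form_add_neq0 (x y : X) t : B x y = 0 -> x <> vzero -> B (x +v t *v y) x <> 0.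
Proof.
  intros E Hx E'. apply form_sym0 in E'. revert E'. lin (Blin x).
  rewrite E, Bself. apply norm_pos in Hx. nra.
Qed.

(** For an inner product and orthogonal [x], [y] this is [t ||y||^2 / ||x||^2]; linearity in [t] is
    the first trace of a Euclidean norm. *)
Definition ratio (x y : X) t := B (x +v t *v y) y / B (x +v t *v y) x.

(* The point [x + (t + s) y + z] lies on the lines joining [x + t y] to
   [z + s y], [x + (t + s) y] to [z], and [x + z] to [(t + s) y]; since
   [form_ker_add] makes [B] compatible with collinearity, comparing the three
   expressions of its functional gives additivity, as in the fundamental
   theorem of projective geometry. *)
Lemma ratio_add (x y z : X) :
  x <> vzero -> y <> vzero -> z <> vzero ->
  B x y = 0 -> B x z = 0 -> B y z = 0 ->
  forall t s, ratio x y (t + s) = ratio x y t + ratio x y s.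
Proof.
  intros Hx Hy Hz Exy Exz Eyz.
  pose proof (form_sym0 _ _ Exy) as Eyx.
  pose proof (form_sym0 _ _ Exz) as Ezx.
  pose proof (form_sym0 _ _ Eyz) as Ezy.
  assert (Wx : forall t, B (x +v t *v y +v z) x <> 0).
  { intros t. replace (x +v t *v y +v z) with (x +v 1 *v (t *v y +v z)) by vec.
    apply form_add_neq0; trivial. lin (Blin x). rewrite Exy, Exz; ring. }
  assert (K : exists k, forall t s, ratio x y (t + s) = ratio x y t + k * ratio z y s).
  { exists (B (x +v z) z / B (x +v z) x). intros t s.
    set (w := x +v (t + s) *v y +v z).
    assert (W1 : B w y / B w x = ratio x y (t + s)).
    { assert (E : B w (y -v ratio x y (t + s) *v x) = 0).
      { apply form_ker_add.
        - lin (Blin (x +v (t + s) *v y)). unfold ratio. field.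
          apply form_add_neq0; trivial.
        - lin (Blin z). rewrite Ezy, Ezx; ring. }
      revert E. lin (Blin w). specialize (Wx (t + s)). fold w in Wx. intros E.
      apply Rminus_diag_uniq in E. rewrite E. field; trivial. }
    assert (W2 : B w z / B w x = B (x +v z) z / B (x +v z) x).
    { assert (N : B (x +v z) x <> 0).
      { replace (x +v z) with (x +v 1 *v z) by vec. apply form_add_neq0; trivial. }
      assert (E : B w (z -v (B (x +v z) z / B (x +v z) x) *v x) = 0).
      { unfold w. replace (x +v (t + s) *v y +v z) with (x +v z +v (t + s) *v y) by vec.
        apply form_ker_add.
        - lin (Blin (x +v z)). field. trivial.
        - rewrite form_scal_l. lin (Blin y). rewrite Eyz, Eyx; ring. }
      revert E. lin (Blin w). specialize (Wx (t + s)). fold w in Wx. intros E.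
      apply Rminus_diag_uniq in E. rewrite E. field; auto. }
    assert (W3 : B w (y -v ratio x y t *v x -v ratio z y s *v z) = 0).
    { unfold w. replace (x +v (t + s) *v y +v z) with (x +v t *v y +v (z +v s *v y)) by vec.
      apply form_ker_add.
      - lin (Blin (x +v t *v y)). replace (B (x +v t *v y) z) with 0.
        + unfold ratio. field. split; apply form_add_neq0; trivial.
        + symmetry. apply form_ker_add; trivial. rewrite form_scal_l, Eyz; ring.
      - lin (Blin (z +v s *v y)). replace (B (z +v s *v y) x) with 0.
        + unfold ratio. field. split; apply form_add_neq0; trivial.
        + symmetry. apply form_ker_add; trivial. rewrite form_scal_l, Eyx; ring. }
    revert W3. lin (Blin w). specialize (Wx (t + s)). fold w in Wx. intros W3.
    rewrite <- W1, <- W2. replace (B w y) with (ratio x y t * B w x + ratio z y s * B w z) by lra.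
    field; trivial. }
  destruct K as [k K].
  assert (K0 : ratio x y 0 = 0).
  { unfold ratio. rewrite vscal_0, vadd_0, Exy. unfold Rdiv; ring. }
  (* At [t = 0] the relation [K] reads [ratio x y s = k * ratio z y s], which eliminates both [k]
     and [z]. *)
  intros t s. rewrite K. f_equal.
  specialize (K 0 s). rewrite Rplus_0_l, K0 in K. lra.
Qed.

(** For [|t|] at most [||x|| / (4 ||y||)] the term [t B w y] takes away at most a quarter of
    [||x|| ||w||] from [||w||^2], so the denominator stays at least [3/4 ||x||^2]. This bound
    replaces continuity when additivity is upgraded to linearity. *)
Lemma ratio_bounded (x y : X) :
  x <> vzero -> y <> vzero -> B x y = 0 ->
  exists d M, 0 < d /\ forall t, Rabs t <= d -> Rabs (ratio x y t) <= M.
Proof.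
  intros Hx Hy E. apply norm_pos in Hx. apply norm_pos in Hy.
  exists (vnorm x / (4 * vnorm y)), (4 * vnorm y / vnorm x). split.
  { apply Rdiv_lt_0_compat; lra. }
  intros t Ht.
  set (w := x +v t *v y). set (m := vnorm x) in *. set (n := vnorm y) in *.
  assert (Htn : Rabs t * n <= m / 4).
  { apply (Rmult_le_compat_r n) in Ht; [|lra].
    replace (m / (4 * n) * n) with (m / 4) in Ht by (field; lra). trivial. }
  assert (W1 : vnorm w <= 5 / 4 * m).
  { pose proof (vnorm_triangle X x (t *v y)) as T. fold w m in T.
    rewrite vnorm_scal in T. fold n in T. lra. }
  assert (W2 : m <= vnorm w) by (apply form_min_l; trivial).
  pose proof (Babs w y) as Wy. fold n in Wy.
  assert (Wx : B w x = vnorm w ^ 2 - t * B w y).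
  { rewrite <- Bself. unfold w at 3. lin (Blin w). ring. }
  assert (Wb : Rabs (t * B w y) <= m / 4 * vnorm w).
  { rewrite Rabs_mult. pose proof (Rabs_pos t). pose proof (Rabs_pos (B w y)). nra. }
  apply Rabs_le_inv in Wb.
  assert (Wp : 3 / 4 * m * m <= B w x) by nra.
  unfold ratio. fold w. unfold Rdiv at 1. rewrite Rabs_mult, Rabs_inv.
  rewrite (Rabs_right (B w x)) by nra.
  assert (0 < m * m) by nra.
  apply (Rmult_le_reg_r (B w x)); [lra|].
  rewrite Rmult_assoc, Rinv_l by lra.
  apply Rle_trans with (5 / 4 * m * n); [nra|].
  apply Rle_trans with (4 * n / m * (3 / 4 * m * m)).
  - replace (4 * n / m * (3 / 4 * m * m)) with (3 * m * n) by (field; lra). nra.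
  - apply Rmult_le_compat_l; trivial. apply Rlt_le, Rdiv_lt_0_compat; lra.
Qed.
End FormProperties.

(** * Additive functions of a real variable and quadratic losses *)

Lemma additive_opp (h : R -> R) :
  (forall s t, h (s + t) = h s + h t) -> forall t, h (- t) = - h t.
Proof.
  intros H t. pose proof (H 0 0) as H0. rewrite Rplus_0_r in H0.
  pose proof (H t (- t)) as H1. rewrite Rplus_opp_r in H1. lra.
Qed.

Lemma additive_mul_INR (h : R -> R) :
  (forall s t, h (s + t) = h s + h t) -> forall n t, h (INR n * t) = INR n * h t.
Proof.
  intros H n t. induction n as [|n IH].
  - simpl INR. rewrite !Rmult_0_l. specialize (H 0 0). rewrite Rplus_0_r in H. lra.
  - rewrite S_INR, Rmult_plus_distr_r, Rmult_1_l, H, IH. ring.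
Qed.

Lemma additive_mul_IZR (h : R -> R) :
  (forall s t, h (s + t) = h s + h t) -> forall k t, h (IZR k * t) = IZR k * h t.
Proof.
  intros H k t.
  destruct (Z_le_gt_dec 0 k) as [Hk|Hk].
  - rewrite <- (Z2Nat.id k), <- INR_IZR_INZ by trivial. apply additive_mul_INR, H.
  - replace k with (- Z.of_nat (Z.to_nat (- k)))%Z by lia.
    rewrite opp_IZR, <- INR_IZR_INZ, Ropp_mult_distr_l_reverse, (additive_opp h H).
    rewrite additive_mul_INR by trivial. ring.
Qed.

Lemma pos_INR_unbounded x : exists n, x < INR n /\ (0 < n)%nat.
Proof.
  destruct (archimed (Rabs x)) as [H _].
  assert (Hk : (0 <= up (Rabs x))%Z).
  { apply le_IZR. pose proof (Rabs_pos x). lra. }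
  exists (S (Z.to_nat (up (Rabs x)))). split; [|lia].
  rewrite S_INR, INR_IZR_INZ, Z2Nat.id by trivial.
  pose proof (Rle_abs x). lra.
Qed.

Lemma bounded_multiples_zero a M : (forall n, INR n * Rabs a <= M) -> a = 0.
Proof.
  intros H. apply NNPP; intros Ha. apply Rabs_pos_lt in Ha.
  destruct (pos_INR_unbounded (M / Rabs a)) as [n [Hn _]].
  specialize (H n). apply (Rmult_lt_compat_r (Rabs a)) in Hn; trivial.
  replace (M / Rabs a * Rabs a) with M in Hn by (field; lra). lra.
Qed.

(** On the grid of step [a = 1/n <= d] the function already agrees with [t * h 1]. Reducing modulo
    the grid bounds the additive difference on the whole line, and a bounded additive function is
    zero. *)
Lemma additive_bounded_linear (h : R -> R) d M :
  (forall s t, h (s + t) = h s + h t) ->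
  0 < d -> (forall t, Rabs t <= d -> Rabs (h t) <= M) ->
  forall t, h t = t * h 1.
Proof.
  intros H Hd HM t.
  destruct (pos_INR_unbounded (/ d)) as [n [Hn Hn0]].
  assert (Hnp : 0 < INR n) by (apply lt_0_INR; trivial).
  set (a := / INR n).
  assert (Ha : 0 < a <= d).
  { split; [apply Rinv_0_lt_compat; trivial|].
    rewrite <- (Rinv_inv d). apply Rinv_le_contravar; [apply Rinv_0_lt_compat|]; lra. }
  assert (Hna : INR n * a = 1) by (unfold a; field; lra).
  assert (H1 : h a = a * h 1).
  { replace (h 1) with (INR n * h a)
      by (rewrite <- (additive_mul_INR h H), Hna; trivial).
    replace (a * (INR n * h a)) with (INR n * a * h a) by ring. rewrite Hna; ring. }
  assert (HB : forall s, Rabs (h s - s * h 1) <= M + d * Rabs (h 1)).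
  { intros s. set (k := Int_part (s / a)).
    assert (Hk : 0 <= s - IZR k * a <= a).
    { destruct (base_Int_part (s / a)) as [K1 K2]. fold k in K1, K2.
      assert (E : s / a * a = s) by (field; lra).
      split; [|]; nra. }
    set (r := s - IZR k * a) in *.
    assert (E : h s - s * h 1 = h r - r * h 1).
    { replace s with (IZR k * a + r) by (unfold r; ring).
      rewrite H, additive_mul_IZR, H1 by trivial. ring. }
    rewrite E. unfold Rminus. eapply Rle_trans; [apply Rabs_triang|].
    rewrite Rabs_Ropp, Rabs_mult.
    assert (Hr : Rabs r <= d) by (rewrite Rabs_right; lra).
    pose proof (Rabs_pos (h 1)). specialize (HM r Hr). nra. }
  assert (E : h t - t * h 1 = 0); [|lra].
  apply (bounded_multiples_zero _ (M + d * Rabs (h 1))). intros m.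
  rewrite <- (Rabs_right (INR m)) by apply Rle_ge, pos_INR.
  rewrite <- Rabs_mult. specialize (HB (INR m * t)).
  rewrite additive_mul_INR in HB by trivial.
  replace (INR m * (h t - t * h 1)) with (INR m * h t - INR m * t * h 1) by ring. trivial.
Qed.

Lemma inv_succ_small e : 0 < e -> exists N, forall n, (n >= N)%nat -> / (INR n + 1) < e.
Proof.
  intros He. destruct (pos_INR_unbounded (/ e)) as [N [HN _]]. exists N. intros n Hn.
  assert (INR N <= INR n) by (apply le_INR; trivial).
  assert (0 < / e) by (apply Rinv_0_lt_compat; trivial).
  rewrite <- (Rinv_inv e). apply Rinv_lt_contravar; [|lra].
  apply Rmult_lt_0_compat; lra.
Qed.

(* Iterating the hypothesis over [n] steps of length [(t - s) / n] costs only
   a factor [1 - c (t - s)^2 / n]. *)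
Lemma constant_of_quadratic_loss (a : R -> R) c :
  0 <= c -> (forall t, 0 < a t) ->
  (forall s t, a s * (1 - c * (t - s) ^ 2) <= a t) ->
  forall s t, a s = a t.
Proof.
  intros Hc Hp H.
  assert (L : forall s t, a s <= a t).
  { intros s t. set (D := c * (t - s) ^ 2).
    assert (HD : 0 <= D) by (unfold D; pose proof (pow2_ge_0 (t - s)); nra).
    apply Rnot_lt_le; intros Hlt.
    (* The summand [D] keeps every factor of the iteration nonnegative; the other one makes the
       total loss, [a s * D / n], smaller than the supposed gap [a s - a t]. *)
    destruct (pos_INR_unbounded (D + a s * D / (a s - a t))) as [n [Hn Hn0]].
    assert (Hsp := Hp s).
    assert (Hq : 0 <= a s * D / (a s - a t)).
    { apply Rmult_le_pos; [nra|]. apply Rlt_le, Rinv_0_lt_compat. lra. }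
    assert (Hnp : 0 < INR n) by (apply lt_0_INR; trivial).
    set (h := (t - s) / INR n).
    assert (Hh : c * h ^ 2 = D / INR n / INR n) by (unfold h, D; field; lra).
    set (e := D / INR n) in *.
    assert (He : e * INR n = D) by (unfold e; field; lra).
    assert (He0 : 0 <= e) by (apply Rmult_le_pos; [lra|apply Rlt_le, Rinv_0_lt_compat; lra]).
    assert (Hn1 : 1 <= INR n) by (change 1 with (INR 1); apply le_INR; lia).
    assert (Hen : 0 <= e / INR n <= 1).
    { split; [apply Rmult_le_pos; [lra|apply Rlt_le, Rinv_0_lt_compat; lra]|].
      apply (Rmult_le_reg_r (INR n)); [lra|].
      replace (e / INR n * INR n) with e by (field; lra). nra. }
    set (g := e / INR n) in *.
    assert (I : forall i, a s * (1 - INR i * g) <= a (s + INR i * h)).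
    { induction i as [|i IH].
      - simpl INR. rewrite !Rmult_0_l, Rplus_0_r. lra.
      - specialize (H (s + INR i * h) (s + INR (S i) * h)).
        replace (s + INR (S i) * h - (s + INR i * h)) with h in H by (rewrite S_INR; ring).
        rewrite Hh in H. pose proof (pos_INR i) as Hi.
        apply Rle_trans with (2 := H).
        apply Rle_trans with (a s * (1 - INR i * g) * (1 - g)).
        + rewrite S_INR. assert (0 <= a s * (INR i * (g * g))).
          { apply Rmult_le_pos; [lra|]. apply Rmult_le_pos; nra. }
          lra.
        + apply Rmult_le_compat_r; lra. }
    specialize (I n). replace (s + INR n * h) with t in I by (unfold h; field; lra).
    replace (INR n * g) with e in I by (unfold g; field; lra).
    assert (a s * D < (a s - a t) * INR n).
    { assert (Q : a s * D / (a s - a t) < INR n) by lra.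
      apply (Rmult_lt_compat_r (a s - a t)) in Q; [|lra].
      replace (a s * D / (a s - a t) * (a s - a t)) with (a s * D) in Q by (field; lra).
      lra. }
    nra. }
  intros; apply Rle_antisym; auto.
Qed.

(** Linearity of the ratio, for which [z] is needed, gives [||x + t y||^2 = a(t) (1 + c t^2)] with
    [a(t)] the coefficient in question. Convexity of the left side then allows [a] only a quadratic
    loss between two points, hence none. *)
Lemma form_coef_const {X : Banach} (B : X -> X -> R) (x y z : X) :
  orthogonality_form B -> strictly_convex X ->
  x <> vzero -> y <> vzero -> z <> vzero ->
  B x y = 0 -> B x z = 0 -> B y z = 0 ->
  forall t, B (x +v t *v y) x = vnorm x ^ 2.
Proof.
  intros HB SC Hx Hy Hz Exy Exz Eyz.
  pose proof (proj1 HB) as Blin. pose proof (proj1 (proj2 HB)) as Bself.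
  assert (Hadd := ratio_add B HB SC x y z Hx Hy Hz Exy Exz Eyz).
  destruct (ratio_bounded B HB x y Hx Hy Exy) as [d [M [Hd HM]]].
  pose proof (additive_bounded_linear _ d M Hadd Hd HM) as HR.
  set (c := ratio B x y 1) in *.
  set (a := fun t => B (x +v t *v y) x).
  set (b := fun t => B (x +v t *v y) y).
  set (m := fun t => vnorm (x +v t *v y) ^ 2).
  assert (Hab : forall t, a t + t * b t = m t).
  { intros t. unfold m. rewrite <- Bself. unfold a, b.
    lin (Blin (x +v t *v y)). ring. }
  assert (Ha0 : forall t, a t <> 0) by (intros t; apply form_add_neq0; trivial).
  assert (Hb : forall t, b t = c * t * a t).
  { intros t. specialize (HR t). unfold ratio in HR. fold (a t) (b t) in HR.
    replace (b t) with (b t / a t * a t) by (field; apply Ha0). rewrite HR; ring. }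
  assert (Hm : forall t, a t * (1 + c * t ^ 2) = m t).
  { intros t. rewrite <- Hab, Hb. ring. }
  assert (Hm0 : forall t, 0 < m t).
  { intros t. unfold m. apply norm_pos in Hx.
    pose proof (form_min_l B HB x y Exy t). nra. }
  (* Otherwise [1 + c t^2] would vanish at [t = sqrt (-1/c)], although the norm there is
     positive. *)
  assert (Hc : 0 <= c).
  { apply Rnot_lt_le; intros Hc.
    specialize (Hm (sqrt (/ - c))). specialize (Hm0 (sqrt (/ - c))).
    assert (0 < / - c) by (apply Rinv_0_lt_compat; lra).
    rewrite pow2_sqrt in Hm by lra.
    replace (1 + c * / - c) with 0 in Hm by (field; lra). lra. }
  assert (Ha : forall t, 0 < a t).
  { intros t. specialize (Hm t). specialize (Hm0 t).
    apply Rnot_le_lt; intros Hle. assert (0 <= c * t ^ 2) by (apply Rmult_le_pos; [lra|apply pow2_ge_0]).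
    assert (a t * (1 + c * t ^ 2) <= 0 * (1 + c * t ^ 2)) by (apply Rmult_le_compat_r; lra).
    lra. }
  (* [b] selects subgradients of the convex function [m / 2]. *)
  assert (Hsub : forall s t, m s + 2 * b s * (t - s) <= m t).
  { intros s t. pose proof (form_le B HB (x +v s *v y) (x +v t *v y)) as H.
    replace (x +v t *v y) with (x +v s *v y +v (t - s) *v y) in H at 1 by vec.
    rewrite (lin_add _ _ _ (Blin _)), (lin_scal _ _ _ (Blin _)), Bself in H.
    fold (m s) (b s) in H. unfold m in *.
    pose proof (pow2_ge_0 (vnorm (x +v s *v y) - vnorm (x +v t *v y))). lra. }
  intros t. change (a t = vnorm x ^ 2).
  assert (E0 : a 0 = vnorm x ^ 2).
  { unfold a. rewrite vscal_0, vadd_0. apply Bself. }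
  rewrite <- E0. apply (constant_of_quadratic_loss a c); trivial.
  (* After substitution the left side of the subgradient inequality is [a s] times
     [1 + c t^2 - c (t - s)^2]; division by [1 + c t^2 >= 1] leaves the required loss. *)
  clear t E0. intros s t. specialize (Hsub s t). rewrite <- !Hm, Hb in Hsub.
  specialize (Ha s).
  assert (0 <= t ^ 2) by apply pow2_ge_0. assert (0 <= (t - s) ^ 2) by apply pow2_ge_0.
  assert (0 <= c * t ^ 2) by (apply Rmult_le_pos; lra).
  assert (0 <= c * (t - s) ^ 2) by (apply Rmult_le_pos; lra).
  apply (Rmult_le_reg_r (1 + c * t ^ 2)); [lra|].
  apply Rle_trans with (2 := Hsub).
  assert (0 <= a s * (c * (t - s) ^ 2) * (c * t ^ 2)) 
    by (apply Rmult_le_pos; [apply Rmult_le_pos|]; lra).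
  lra.
Qed.

(** The dimension hypothesis feeds [form_coef_const]. Splitting [y] into a multiple of [x] and an
    orthogonal part, that lemma gives symmetry of [B], and symmetry carries linearity over to the
    first slot. *)
Lemma hilbert_of_orthogonality_form {X : Banach} (B : X -> X -> R) :
  orthogonality_form B -> strictly_convex X ->
  (forall x y : X, B x y = 0 -> x <> vzero -> y <> vzero ->
    exists z, z <> vzero /\ B x z = 0 /\ B y z = 0) ->
  is_hilbert X.
Proof.
  intros HB SC Hdim.
  pose proof (proj1 HB) as Blin. pose proof (proj1 (proj2 HB)) as Bself.
  assert (Bsym : forall x y, B x y = B y x).
  { intros x y. destruct (classic (x = vzero)) as [->|Hx].
    { rewrite form_zero_l by trivial. symmetry; apply lin_zero, Blin. }
    pose proof (norm_pos x Hx) as Hp.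
    set (s := B x y / vnorm x ^ 2). set (y' := y -v s *v x).
    assert (E : B x y' = 0).
    { unfold y'. lin (Blin x). rewrite Bself. unfold s. field. lra. }
    assert (Es : B x y = s * vnorm x ^ 2) by (unfold s; field; lra).
    assert (Ey : y = y' +v s *v x) by (unfold y'; vec).
    destruct (Req_dec s 0) as [Hs|Hs].
    { rewrite Es, Hs. rewrite Ey, Hs, vscal_0, vadd_0.
      rewrite (form_sym0 B HB SC _ _ E). ring. }
    rewrite Es, Ey.
    destruct (classic (y' = vzero)) as [Hy|Hy].
    { rewrite Hy, vadd_comm, vadd_0, form_scal_l, Bself by trivial. ring. }
    replace (y' +v s *v x) with (s *v (x +v (/ s) *v y')) by vec.
    rewrite form_scal_l by trivial. f_equal. symmetry.
    destruct (Hdim x y' E Hx Hy) as [z [Hz [E1 E2]]].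
    apply (form_coef_const B x y' z); trivial. }
  exists B. repeat split.
  - intros x y z. rewrite !(Bsym _ z). apply lin_add, Blin.
  - intros a x y. rewrite !(Bsym _ y). apply lin_scal, Blin.
  - apply Bsym.
  - intros x. rewrite Bself. apply pow2_ge_0.
  - intros x. rewrite Bself, sqrt_pow2; trivial. apply norm_ge0.
Qed.

(** * Normed planes with a dense orbit *)

Definition lin_isometry {X : Banach} (T : X -> X) : Prop :=
  linear_op T /\ forall x, vnorm (T x) = vnorm x.

Definition inverse_isometries {X : Banach} (T S : X -> X) : Prop :=
  lin_isometry T /\ lin_isometry S /\ (forall x, T (S x) = x) /\ (forall x, S (T x) = x).

(* Strict concavity of [sqrt (a c - b^2)], made quantitative.  Only the leading
   coefficients are compared: below they are the values of the two forms at the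
   base point of an orbit and at its image. *)
Lemma det_almost_max a b c a' b' c' D e :
  0 < a <= 1 -> 0 < a' <= 1 -> 0 <= e ->
  D - e <= a * c - b ^ 2 <= D ->
  D - e <= a' * c' - b' ^ 2 <= D ->
  (a + a') / 2 * ((c + c') / 2) - ((b + b') / 2) ^ 2 <= D ->
  (a' - a) ^ 2 * (D - e) <= 7 * e.
Proof.
  intros Ha Ha' He H1 H2 H3.
  set (x := a' - a). set (y := b' - b). set (z := c' - c).
  set (s := y ^ 2 - x * z).
  set (L := a * z + c * x - 2 * b * y).
  assert (E2 : a' * c' - b' ^ 2 = a * c - b ^ 2 + L - s).
  { unfold L, s, x, y, z. ring. }
  assert (E3 : (a + a') / 2 * ((c + c') / 2) - ((b + b') / 2) ^ 2
     = a * c - b ^ 2 + L / 2 - s / 4).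
  { unfold L, s, x, y, z. field. }
  rewrite E2 in H2. rewrite E3 in H3.
  assert (Hs : s <= 6 * e) by lra.
  assert (Hx : -1 <= x <= 1) by (unfold x; lra).
  (* This identity isolates [(a' - a)^2] times the determinant. [K2] rewrites its right side in
     terms of [s] and [d] with coefficients of modulus at most 1; [s <= 6 e] and [d <= e] in modulus
     give the constant 7. *)
  assert (K : (a * y - b * x) ^ 2 + (a * c - b ^ 2) * x ^ 2 = a ^ 2 * s + a * x * L).
  { unfold s, L. ring. }
  pose proof (pow2_ge_0 (a * y - b * x)). pose proof (pow2_ge_0 x).
  set (d := L - s). assert (Hd : - e <= d <= e) by (unfold d; lra).
  assert (K2 : a ^ 2 * s + a * x * L = a * a' * s + a * x * d).
  { unfold d, x. ring. }
  assert (0 < a * a' <= 1) by (split; nra).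
  assert (a * a' * s <= 6 * e) by nra.
  assert (-1 <= a * x <= 1) by (split; nra).
  assert (a * x * d <= e) by nra.
  nra.
Qed.

Lemma Rle_abs_of_sqr a b : 0 <= b -> a ^ 2 <= b ^ 2 -> Rabs a <= b.
Proof.
  intros Hb H. rewrite <- (Rabs_right b) by lra. apply Rsqr_le_abs_0. unfold Rsqr; lra.
Qed.

Lemma small_zero a K : (forall e, 0 < e -> Rabs a <= e * K) -> a = 0.
Proof.
  intros H. apply (bounded_multiples_zero _ K). intros [|n].
  - simpl INR. rewrite Rmult_0_l. specialize (H 1 Rlt_0_1). pose proof (Rabs_pos a). lra.
  - assert (Hp : 0 < INR (S n)) by (apply lt_0_INR; lia).
    specialize (H (/ INR (S n)) (Rinv_0_lt_compat _ Hp)).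
    apply (Rmult_le_compat_l (INR (S n))) in H; [|lra].
    replace (INR (S n) * (/ INR (S n) * K)) with K in H by (field; lra). trivial.
Qed.

Section Plane.
Context {X : Banach} (e f : X).
Context (He : vnorm e = 1) (Hf : f <> vzero).
Context (span : forall x, exists s t, x = s *v e +v t *v f).
Context (Hs : forall s t, Rabs s <= vnorm (s *v e +v t *v f)).
Context (Ht : forall s t, Rabs t * vnorm f <= vnorm (s *v e +v t *v f)).

Let N s t := vnorm (s *v e +v t *v f).
Let M := vnorm f ^ 2.

Lemma plane_coords_unique s t s' t' :
  s *v e +v t *v f = s' *v e +v t' *v f -> s = s' /\ t = t'.
Proof.
  intros E.
  assert (E' : vnorm ((s - s') *v e +v (t - t') *v f) = 0).
  { replace ((s - s') *v e +v (t - t') *v f)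
      with ((s *v e +v t *v f) -v (s' *v e +v t' *v f)) by vec.
    rewrite E. replace (s' *v e +v t' *v f -v (s' *v e +v t' *v f)) with (@vzero X) by vec.
    apply norm_zero. }
  pose proof (Hs (s - s') (t - t')) as H1. pose proof (Ht (s - s') (t - t')) as H2.
  rewrite E' in H1, H2. pose proof (norm_pos f Hf).
  pose proof (Rabs_pos (s - s')). pose proof (Rabs_pos (t - t')).
  assert (Rabs (t - t') = 0) by nra.
  split; apply Rminus_diag_uniq; apply NNPP; intros A; apply Rabs_pos_lt in A; lra.
Qed.

Definition quad (a b c s t : R) := a * s ^ 2 + 2 * b * s * t + c * t ^ 2.

(** The nondegenerate forms among these are the ellipses containing the unit ball; a large
    determinant means a small area. *)
Let adm a b c := forall s t, 0 <= quad a b c s t <= N s t ^ 2.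

Let M_pos : 0 < M.
Proof. unfold M. pose proof (norm_pos f Hf). nra. Qed.

Let adm_le a b c : adm a b c -> 0 <= a <= 1 /\ 0 <= c <= M.
Proof.
  intros H. pose proof (H 1 0) as H1. pose proof (H 0 1) as H2. unfold quad, N in *.
  replace (1 *v e +v 0 *v f) with e in H1 by vec.
  replace (0 *v e +v 1 *v f) with f in H2 by vec.
  rewrite He in H1. fold M in H2. lra.
Qed.

Let dets d := exists a b c, adm a b c /\ d = a * c - b ^ 2.

(** This is the mean of the squared norms of the two components, each of which is at most the
    squared norm. Its determinant makes the supremum positive. *)
Let adm_init : adm (/ 2) 0 (M / 2).
Proof.
  intros s t. unfold quad. pose proof (Hs s t) as H1. pose proof (Ht s t) as H2.
  fold (N s t) in H1, H2. pose proof M_pos.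
  pose proof (pow2_ge_0 s). pose proof (pow2_ge_0 t). split; [nra|].
  assert (s ^ 2 <= N s t ^ 2).
  { rewrite <- (pow2_abs s). apply pow_incr. split; [apply Rabs_pos|trivial]. }
  assert (t ^ 2 * M <= N s t ^ 2).
  { unfold M. rewrite <- (pow2_abs t), <- Rpow_mult_distr. apply pow_incr.
    split; trivial. apply Rmult_le_pos; [apply Rabs_pos|apply norm_ge0]. }
  lra.
Qed.

Let max_det : exists D, 0 < D /\ is_lub dets D.
Proof.
  destruct (completeness dets) as [D HD].
  - exists M. intros d [a [b [c [H ->]]]]. apply adm_le in H. pose proof (pow2_ge_0 b). nra.
  - exists (/ 2 * (M / 2) - 0 ^ 2), (/ 2), 0, (M / 2). split; [exact adm_init|reflexivity].
  - exists D. split; trivial. pose proof M_pos.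
    apply Rlt_le_trans with (/ 2 * (M / 2) - 0 ^ 2); [nra|].
    apply HD. exists (/ 2), 0, (M / 2). split; [exact adm_init|reflexivity].
Qed.

Let isometry_coords T : lin_isometry T -> exists p r m n,
  T e = p *v e +v r *v f /\ T f = m *v e +v n *v f /\
  forall a b c, adm a b c ->
  adm (quad a b c p r) (a * p * m + b * (p * n + r * m) + c * r * n) (quad a b c m n).
Proof.
  intros [[T1 T2] T3].
  destruct (span (T e)) as [p [r Ee]]. destruct (span (T f)) as [m [n Ef]].
  exists p, r, m, n. split; [|split]; trivial.
  intros a b c H s t. specialize (H (s * p + t * m) (s * r + t * n)).
  assert (EN : N s t = N (s * p + t * m) (s * r + t * n)).
  { unfold N. rewrite <- T3, T1, !T2, Ee, Ef. f_equal. vec. }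
  rewrite EN. revert H. unfold quad. intros H.
  match type of H with 0 <= ?u <= _ => match goal with |- 0 <= ?v <= _ =>
    replace v with u by ring end end. trivial.
Qed.

(** Pulling back along [T] keeps forms admissible and multiplies all determinants by [(det T)^2]; a
    factor above 1 would exceed the supremum. Applied to the inverse as well, it yields
    [(det T)^2 = 1]. *)
Let isometry_det_le D T p r m n : is_lub dets D -> 0 < D -> lin_isometry T ->
  T e = p *v e +v r *v f -> T f = m *v e +v n *v f -> (p * n - m * r) ^ 2 <= 1.
Proof.
  intros HD HD0 HT Ee Ef.
  destruct (isometry_coords T HT) as [p' [r' [m' [n' [Ee' [Ef' HT']]]]]].
  rewrite Ee in Ee'. rewrite Ef in Ef'.
  apply plane_coords_unique in Ee' as [<- <-]. apply plane_coords_unique in Ef' as [<- <-].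
  set (d := (p * n - m * r) ^ 2).
  assert (Hd : 0 <= d) by apply pow2_ge_0.
  apply Rnot_lt_le; intros Hlt.
  assert (HDd : D <= D / d).
  { apply HD. intros x [a [b [c [H ->]]]]. apply HT' in H.
    apply (Rmult_le_reg_r d); [lra|]. replace (D / d * d) with D by (field; lra).
    apply (proj1 HD). eexists _, _, _; split; [exact H|].
    unfold d, quad. ring. }
  apply (Rmult_le_compat_r d) in HDd; [|lra].
  replace (D / d * d) with D in HDd by (field; lra). nra.
Qed.

Context (dense : forall w : X, vnorm w = 1 -> forall eps, 0 < eps ->
  exists T S, inverse_isometries T S /\ vnorm (w -v T e) < eps).

(** The difference of two values of a quadratic form is its bilinear form at the difference and the
    sum of the arguments, so this is Cauchy-Schwarz. *)
Let quad_sub_le a b c s t s' t' : adm a b c -> 0 <= a * c - b ^ 2 ->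
  Rabs (quad a b c s t - quad a b c s' t') <= N (s - s') (t - t') * N (s + s') (t + t').
Proof.
  intros H Hdet. set (x := s - s'). set (y := t - t'). set (z := s + s'). set (w := t + t').
  replace (quad a b c s t - quad a b c s' t')
    with (a * x * z + b * (x * w + y * z) + c * y * w)
    by (unfold quad, x, y, z, w; ring).
  apply Rle_abs_of_sqr; [apply Rmult_le_pos; apply norm_ge0|].
  apply Rle_trans with (quad a b c x y * quad a b c z w).
  - replace (quad a b c x y * quad a b c z w) with
      ((a * x * z + b * (x * w + y * z) + c * y * w) ^ 2
       + (a * c - b ^ 2) * (x * w - y * z) ^ 2) by (unfold quad; ring).
    pose proof (pow2_ge_0 (x * w - y * z)). nra.
  - rewrite Rpow_mult_distr. apply Rmult_le_compat; apply H.
Qed.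

Let almost_invariant D h : is_lub dets D -> 0 < D -> 0 < h ->
  exists a b c, adm a b c /\ D / (2 * M) <= a /\
  forall s t, N s t = 1 -> Rabs (quad a b c s t - a) <= 3 * h.
Proof.
  intros HD HD0 Hh. pose proof M_pos as HM.
  (* [det_almost_max] gives [(a' - a)^2 (D - eps) <= 7 eps]; here [D - eps >= D / 2] and
     [7 eps <= h^2 D / 2], so [a] moves by at most [h]. Passing from the orbit point to the given
     unit vector costs [2 h] more. *)
  set (eps := Rmin (D / 2) (h ^ 2 * D / 14)).
  assert (Heps : 0 < eps <= D / 2 /\ eps <= h ^ 2 * D / 14).
  { unfold eps. split; [split|].
    - apply Rmin_glb_lt; [lra|]. assert (0 < h ^ 2 * D) by (apply Rmult_lt_0_compat; nra). lra.
    - apply Rmin_l.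
    - apply Rmin_r. }
  assert (Hex : exists d, dets d /\ D - eps < d).
  { apply NNPP; intros HN. assert (D <= D - eps); [|lra].
    apply HD. intros d Hd. apply Rnot_lt_le; intros Hlt. apply HN. exists d; auto. }
  destruct Hex as [d [[a [b [c [Ha ->]]]] Hd]].
  exists a, b, c. split; [trivial|].
  pose proof (adm_le _ _ _ Ha) as [Ba Bc]. pose proof (pow2_ge_0 b).
  assert (Ha0 : D / (2 * M) <= a).
  { apply (Rmult_le_reg_r (2 * M)); [lra|].
    replace (D / (2 * M) * (2 * M)) with D by (field; lra). nra. }
  assert (Hap : 0 < D / (2 * M)) by (apply Rdiv_lt_0_compat; lra).
  split; [trivial|]. intros s t Hst.
  destruct (dense (s *v e +v t *v f) Hst h Hh) as [T [S [[HT [HS [TS _]]] Hd']]].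
  destruct (isometry_coords T HT) as [p [r [m [n [Ee [Ef HT']]]]]].
  destruct (isometry_coords S HS) as [p' [r' [m' [n' [Ee' [Ef' _]]]]]].
  pose proof (isometry_det_le D T p r m n HD HD0 HT Ee Ef) as D1.
  pose proof (isometry_det_le D S p' r' m' n' HD HD0 HS Ee' Ef') as D2.
  assert (DD : (p * n - m * r) * (p' * n' - m' * r') = 1).
  { pose proof (TS e) as E1. pose proof (TS f) as E2.
    destruct HT as [[T1 T2] _].
    rewrite Ee', T1, !T2, Ee, Ef in E1. rewrite Ef', T1, !T2, Ee, Ef in E2.
    assert (F1 : (p' * p + r' * m) *v e +v (p' * r + r' * n) *v f = 1 *v e +v 0 *v f).
    { transitivity e; [etransitivity; [|exact E1]|]; vec. }
    assert (F2 : (m' * p + n' * m) *v e +v (m' * r + n' * n) *v f = 0 *v e +v 1 *v f).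
    { transitivity f; [etransitivity; [|exact E2]|]; vec. }
    apply plane_coords_unique in F1 as [F11 F12].
    apply plane_coords_unique in F2 as [F21 F22].
    replace 1 with ((p' * p + r' * m) * (m' * r + n' * n)
      - (p' * r + r' * n) * (m' * p + n' * m)) by (rewrite F11, F12, F21, F22; ring).
    ring. }
  assert (D3 : (p * n - m * r) ^ 2 = 1).
  { apply Rle_antisym; trivial.
    replace 1 with (((p * n - m * r) * (p' * n' - m' * r')) ^ 2) by (rewrite DD; ring).
    rewrite Rpow_mult_distr. pose proof (pow2_ge_0 (p * n - m * r)). nra. }
  pose proof (HT' a b c Ha) as Ha'.
  set (a' := quad a b c p r) in *.
  set (b' := a * p * m + b * (p * n + r * m) + c * r * n) in *.
  set (c' := quad a b c m n) in *.
  assert (Edet : a' * c' - b' ^ 2 = a * c - b ^ 2).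
  { replace (a' * c' - b' ^ 2) with ((a * c - b ^ 2) * (p * n - m * r) ^ 2)
      by (unfold a', b', c', quad; ring). rewrite D3; ring. }
  pose proof (adm_le _ _ _ Ha') as [Ba' Bc']. pose proof (pow2_ge_0 b').
  assert (Hdet : a * c - b ^ 2 <= D).
  { apply HD. exists a, b, c; auto. }
  assert (K : (a' - a) ^ 2 * (D - eps) <= 7 * eps).
  { apply (det_almost_max a b c a' b' c'); try lra.
    - split; [|lra]. nra.
    - apply HD. eexists _, _, _; split; [|reflexivity].
      intros x y. specialize (Ha x y). specialize (Ha' x y). unfold quad in *.
      lra. }
  assert (K2 : Rabs (a' - a) <= h).
  { apply Rle_abs_of_sqr; [lra|].
    apply (Rmult_le_reg_r (D / 2)); [lra|].
    pose proof (pow2_ge_0 (a' - a)). nra. }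
  assert (K3 : Rabs (quad a b c s t - a') <= 2 * h).
  { unfold a'. eapply Rle_trans; [apply quad_sub_le; trivial; lra|].
    assert (N (s - p) (t - r) < h).
    { unfold N. replace ((s - p) *v e +v (t - r) *v f) with (s *v e +v t *v f -v T e)
        by (rewrite Ee; vec). trivial. }
    assert (N (s + p) (t + r) <= 2).
    { unfold N. replace ((s + p) *v e +v (t + r) *v f) with (s *v e +v t *v f +v T e)
        by (rewrite Ee; vec).
      eapply Rle_trans; [apply vnorm_triangle|].
      destruct HT as [_ HT]. fold (N s t). rewrite HT, He. lra. }
    assert (0 <= N (s - p) (t - r)) by apply norm_ge0.
    assert (0 <= N (s + p) (t + r)) by apply norm_ge0. nra. }
  replace (quad a b c s t - a) with (quad a b c s t - a' + (a' - a)) by ring.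
  eapply Rle_trans; [apply Rabs_triang|]. lra.
Qed.

(** No optimal form is constructed. The almost invariant forms approximate multiples of [N^2], and a
    binary form is determined by its values at (1,0), (0,1) and (1,1), so [N^2] is compared with one
    fixed form having its own values there. The lower bound [k] on [a], independent of [h], allows
    division before [h] tends to 0. *)
Let norm_quadratic : exists b, forall s t, N s t ^ 2 = quad 1 b M s t.
Proof.
  destruct max_det as [D [HD0 HD]]. pose proof M_pos as HM.
  set (k := D / (2 * M)). assert (Hk : 0 < k) by (apply Rdiv_lt_0_compat; lra).
  exists ((N 1 1 ^ 2 - 1 - M) / 2). intros s t.
  apply Rminus_diag_uniq.
  assert (N10 : N 1 0 = 1).
  { unfold N. rewrite <- He. f_equal. vec. }
  assert (N01 : N 0 1 ^ 2 = M).
  { unfold N, M. do 2 f_equal. vec. }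
  apply (small_zero _ (3 / k * (N s t ^ 2 + s ^ 2 + t ^ 2 * M
    + Rabs (s * t) * (N 1 1 ^ 2 + 1 + M)))).
  intros h Hh.
  destruct (almost_invariant D h HD HD0 Hh) as [a [b [c [Ha [Hak Hq]]]]]. fold k in Hak.
  assert (Q : forall x y, Rabs (a * N x y ^ 2 - quad a b c x y) <= 3 * h * N x y ^ 2).
  { intros x y. destruct (Req_dec (N x y) 0) as [E|E].
    - specialize (Ha x y). rewrite E in *.
      replace (quad a b c x y) with 0 by lra.
      replace (a * 0 ^ 2 - 0) with 0 by ring. rewrite Rabs_R0. lra.
    - assert (P : 0 < N x y) by (assert (0 <= N x y) by apply norm_ge0; lra).
      set (n := N x y) in *. specialize (Hq (x / n) (y / n)).
      assert (E1 : N (x / n) (y / n) = 1).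
      { unfold N. replace ((x / n) *v e +v (y / n) *v f)
          with (/ n *v (x *v e +v y *v f)) by vec.
        apply norm_normalize. intros E0. apply E. unfold n, N. rewrite E0. apply norm_zero. }
      specialize (Hq E1).
      replace (a * n ^ 2 - quad a b c x y) with (n ^ 2 * - (quad a b c (x / n) (y / n) - a))
        by (unfold quad; field; lra).
      rewrite Rabs_mult, Rabs_Ropp, Rabs_right by (apply Rle_ge, pow2_ge_0).
      rewrite (Rmult_comm (3 * h)). apply Rmult_le_compat_l; [apply pow2_ge_0|trivial]. }
  pose proof (Q s t) as Q1. pose proof (Q 1 0) as Q2. pose proof (Q 0 1) as Q3.
  pose proof (Q 1 1) as Q4. rewrite N10 in Q2. rewrite N01 in Q3.
  set (G := N s t ^ 2 - quad 1 ((N 1 1 ^ 2 - 1 - M) / 2) M s t).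
  set (u1 := a * N s t ^ 2 - quad a b c s t) in *.
  set (u2 := a * 1 ^ 2 - quad a b c 1 0) in *.
  set (u3 := a * M - quad a b c 0 1) in *.
  set (u4 := a * N 1 1 ^ 2 - quad a b c 1 1) in *.
  assert (EG : a * G = u1 - s ^ 2 * u2 - t ^ 2 * u3 - s * t * (u4 - u2 - u3)).
  { unfold G, u1, u2, u3, u4, quad. field. }
  set (K := N s t ^ 2 + s ^ 2 + t ^ 2 * M + Rabs (s * t) * (N 1 1 ^ 2 + 1 + M)).
  assert (HG : Rabs (a * G) <= 3 * h * K).
  { rewrite EG. unfold Rminus at 1 2 3.
    pose proof (pow2_ge_0 s). pose proof (pow2_ge_0 t). pose proof (Rabs_pos (s * t)).
    eapply Rle_trans; [apply Rabs_triang|]. rewrite Rabs_Ropp, Rabs_mult.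
    assert (Rabs (u4 - u2 - u3) <= 3 * h * (N 1 1 ^ 2 + 1 + M)).
    { unfold Rminus. eapply Rle_trans; [apply Rabs_triang|]. rewrite Rabs_Ropp.
      pose proof (Rabs_triang u4 (- u2)) as T. rewrite Rabs_Ropp in T. lra. }
    assert (Rabs (u1 + - (s ^ 2 * u2) + - (t ^ 2 * u3)) <=
      3 * h * (N s t ^ 2 + s ^ 2 + t ^ 2 * M)).
    { eapply Rle_trans; [apply Rabs_triang|]. rewrite Rabs_Ropp, Rabs_mult.
      pose proof (Rabs_triang u1 (- (s ^ 2 * u2))) as T.
      rewrite Rabs_Ropp, Rabs_mult in T.
      rewrite (Rabs_right (s ^ 2)) in T by lra. rewrite (Rabs_right (t ^ 2)) by lra.
      nra. }
    unfold K. nra. }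
  rewrite Rabs_mult, (Rabs_right a) in HG by lra.
  assert (k * Rabs G <= 3 * h * K) by (pose proof (Rabs_pos G); nra).
  apply (Rmult_le_reg_l k); trivial.
  replace (k * (h * (3 / k * K))) with (3 * h * K) by (field; lra). trivial.
Qed.

Lemma hilbert_of_dense_orbit_plane : is_hilbert X.
Proof.
  destruct norm_quadratic as [b Hb].
  set (c1 := fun x => proj1_sig (constructive_indefinite_description _ (span x))).
  assert (Hc1 : forall x, exists t, x = c1 x *v e +v t *v f).
  { intros x. unfold c1. destruct constructive_indefinite_description; trivial. }
  set (c2 := fun x => proj1_sig (constructive_indefinite_description _ (Hc1 x))).
  assert (Hc : forall x, x = c1 x *v e +v c2 x *v f).
  { intros x. unfold c2. destruct constructive_indefinite_description; trivial. }
  clearbody c1 c2.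
  assert (Cadd : forall x y, c1 (x +v y) = c1 x + c1 y /\ c2 (x +v y) = c2 x + c2 y).
  { intros x y. apply plane_coords_unique. rewrite <- Hc.
    rewrite (Hc x) at 1. rewrite (Hc y) at 1. vec. }
  assert (Cscal : forall a x, c1 (a *v x) = a * c1 x /\ c2 (a *v x) = a * c2 x).
  { intros a x. apply plane_coords_unique. rewrite <- Hc. rewrite (Hc x) at 1. vec. }
  assert (HN : forall x, quad 1 b M (c1 x) (c2 x) = vnorm x ^ 2).
  { intros x. rewrite <- Hb. unfold N. rewrite <- Hc. reflexivity. }
  exists (fun x y => c1 x * c1 y + b * (c1 x * c2 y + c2 x * c1 y) + M * c2 x * c2 y).
  repeat split.
  - intros x y z. destruct (Cadd x y) as [-> ->]. ring.
  - intros a x y. destruct (Cscal a x) as [-> ->]. ring.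
  - intros x y. ring.
  - intros x. replace (_ + _) with (quad 1 b M (c1 x) (c2 x)) by (unfold quad; ring).
    rewrite HN. apply pow2_ge_0.
  - intros x. replace (_ + _) with (quad 1 b M (c1 x) (c2 x)) by (unfold quad; ring).
    rewrite HN, sqrt_pow2; trivial. apply norm_ge0.
Qed.
End Plane.

(** * Bicontractive functionals as limits *)

Lemma nearest_point_exists {X : Banach} (x y : X) :
  vnorm x = 1 -> exists t, forall s, vnorm (y -v t *v x) <= vnorm (y -v s *v x).
Proof.
  intros Hx. set (g := fun s => vnorm (y -v s *v x)). pose proof (norm_ge0 y) as Hy.
  assert (Hlip : forall s t, g s <= g t + Rabs (s - t)).
  { intros s t. unfold g.
    replace (Rabs (s - t)) with (vnorm ((t - s) *v x))
      by (rewrite vnorm_scal, Hx, Rabs_minus_sym; ring).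
    apply norm_le_add. vec. }
  assert (Hc : forall c, continuity_pt g c).
  { intros c e He. exists e. split; trivial. intros s [_ Hs].
    simpl in *. unfold R_dist in *.
    pose proof (Hlip s c). pose proof (Hlip c s) as H2.
    rewrite (Rabs_minus_sym c s) in H2.
    apply Rle_lt_trans with (2 := Hs). apply Rabs_le. lra. }
  (* Outside this interval [||y - s x|| >= |s| - ||y|| > ||y||], which is the value at [s = 0]. *)
  destruct (continuity_ab_min g (- (2 * vnorm y)) (2 * vnorm y)) as [t [Ht _]].
  { lra. }
  { intros; apply Hc. }
  exists t. intros s. change (g t <= g s).
  destruct (Rle_dec (Rabs s) (2 * vnorm y)) as [Hs|Hs].
  - apply Ht. apply Rabs_le_inv in Hs. trivial.
  - apply Rle_trans with (g 0); [apply Ht; lra|].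
    assert (g 0 = vnorm y) as -> by (unfold g; f_equal; vec).
    assert (vnorm (s *v x) <= vnorm y + g s).
    { unfold g. rewrite (norm_sub_sym y). rewrite Rplus_comm. apply norm_le_add. vec. }
    rewrite vnorm_scal, Hx in H. lra.
Qed.

Lemma Un_cv_abs_le (u : nat -> R) l c :
  Un_cv u l -> (forall n, Rabs (u n) <= c) -> Rabs l <= c.
Proof.
  intros Hu Hc. apply Rnot_lt_le; intros Hlt.
  destruct (Hu (Rabs l - c)) as [N HN]; [lra|].
  specialize (HN N (le_n N)). specialize (Hc N). unfold R_dist in HN.
  rewrite Rabs_minus_sym in HN.
  pose proof (Rabs_triang_inv l (u N)). lra.
Qed.

Lemma Un_cv_ext_eq (u v : nat -> R) l : (forall n, u n = v n) -> Un_cv u l -> Un_cv v l.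
Proof.
  intros E H eps He. destruct (H eps He) as [N HN]. exists N. intros n Hn.
  rewrite <- E. auto.
Qed.

Lemma Un_cv_const (c : R) : Un_cv (fun _ => c) c.
Proof.
  intros eps He. exists 0%nat. intros n _. unfold R_dist. rewrite Rminus_diag, Rabs_R0. trivial.
Qed.

(** With [z = y - t x], contractivity keeps [||z - s v_n||] below [||z||] for [s] between 0 and
    [f n z]. Uniqueness of the nearest point and semicontinuity forbid this at [s = eps] and
    [s = - eps] for large [n], so [f n z] tends to 0. *)
Lemma nearest_point_cv {X : Banach} (x y : X) t (v : nat -> X) (f : nat -> X -> R) :
  strictly_convex X -> vnorm x = 1 ->
  (forall n, lin_functional (f n)) ->
  (forall n y, vnorm (y -v f n y *v v n) <= vnorm y) ->
  Un_cv (fun n => f n x) 1 ->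
  (forall y s eps, 0 < eps -> exists N, forall n, (n >= N)%nat ->
     vnorm (y -v s *v x) - eps <= vnorm (y -v s *v v n)) ->
  (forall s, vnorm (y -v t *v x) <= vnorm (y -v s *v x)) ->
  Un_cv (fun n => f n y) t.
Proof.
  intros SC Hx Hf Hc Hfx Hlsc Ht.
  set (z := y -v t *v x).
  assert (Hx0 : x <> vzero).
  { intros ->. rewrite norm_zero in Hx. lra. }
  assert (Hz : forall s, vnorm z <= vnorm (z +v s *v x)).
  { intros s. unfold z. replace (y -v t *v x +v s *v x) with (y -v (t - s) *v x) by vec.
    apply Ht. }
  assert (Hgap : forall s, s <> 0 -> exists N, forall n, (n >= N)%nat ->
    vnorm z < vnorm (z -v s *v v n)).
  { intros s Hs.
    assert (Hlt : vnorm z < vnorm (z -v s *v x)).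
    { apply Rnot_le_lt; intros Hle. apply Hs.
      assert (E : (- s) *v x = vzero).
      { apply (strictly_convex_min_unique z x); trivial. intros r.
        replace (z +v (- s) *v x) with (z -v s *v x) at 1 by vec.
        apply Rle_trans with (1 := Hle).
        replace (z +v (- s) *v x +v r *v x) with (z +v (r - s) *v x) by vec. apply Hz. }
      apply vscal_eq0 in E; trivial. lra. }
    destruct (Hlsc z s ((vnorm (z -v s *v x) - vnorm z) / 2)) as [N HN]; [lra|].
    exists N. intros n Hn. specialize (HN n Hn). lra. }
  assert (Hcv : Un_cv (fun n => f n z) 0).
  { intros eps Heps.
    destruct (Hgap eps) as [N1 H1]; [lra|]. destruct (Hgap (- eps)) as [N2 H2]; [lra|].
    exists (max N1 N2). intros n Hn. unfold R_dist. rewrite Rminus_0_r.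
    (* [s |-> ||z - s v_n||] is convex, at most [||z||] at [f n z] and more
       than [||z||] at [eps] and [- eps]. *)
    assert (K : forall s, 0 < s / f n z <= 1 -> vnorm (z -v s *v v n) <= vnorm z).
    { intros s Hs. assert (f n z <> 0).
      { intros E. rewrite E in Hs. unfold Rdiv in Hs. rewrite Rinv_0 in Hs. lra. }
      set (r := s / f n z) in *.
      replace (vnorm z) with (vnorm ((1 - r) *v z) + r * vnorm z)
        by (rewrite vnorm_scal, Rabs_right by lra; ring).
      apply Rle_trans with (vnorm ((1 - r) *v z) + vnorm (r *v (z -v f n z *v v n))).
      - apply norm_le_add. vec. unfold r. field. trivial.
      - apply Rplus_le_compat_l. rewrite vnorm_scal, Rabs_right by lra.
        apply Rmult_le_compat_l; [lra|apply Hc]. }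
    apply Rabs_def1; apply Rnot_le_lt; intros Hle.
    - specialize (H1 n ltac:(lia)). specialize (K eps).
      assert (0 < eps / f n z <= 1); [|specialize (K H); lra].
      split; [apply Rdiv_lt_0_compat; lra|].
      apply (Rmult_le_reg_r (f n z)); [lra|]. unfold Rdiv. rewrite Rmult_assoc, Rinv_l; lra.
    - specialize (H2 n ltac:(lia)). specialize (K (- eps)).
      assert (0 < - eps / f n z <= 1); [|specialize (K H); lra].
      replace (- eps / f n z) with (eps / - f n z) by (field; lra).
      split; [apply Rdiv_lt_0_compat; lra|].
      apply (Rmult_le_reg_r (- f n z)); [lra|]. unfold Rdiv. rewrite Rmult_assoc, Rinv_l; lra. }
  apply Un_cv_ext_eq with (fun n => f n z + t * f n x).
  { intros n. unfold z. lin (Hf n). ring. }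
  replace t with (0 + t * 1) at 1 by ring.
  apply CV_plus; trivial. apply CV_mult; trivial. apply Un_cv_const.
Qed.

(** The coordinate of the nearest point is not evidently linear in [y]; it becomes so as the
    pointwise limit of the [f n]. *)
Lemma bicontractive_limit {X : Banach} (x : X) (v : nat -> X) (f : nat -> X -> R) :
  strictly_convex X -> vnorm x = 1 ->
  (forall n, dual_ball (f n)) ->
  (forall n y, vnorm (y -v f n y *v v n) <= vnorm y) ->
  Un_cv (fun n => f n x) 1 ->
  (forall y s eps, 0 < eps -> exists N, forall n, (n >= N)%nat ->
     vnorm (y -v s *v x) - eps <= vnorm (y -v s *v v n)) ->
  exists g, bicontractive_at x g.
Proof.
  intros SC Hx Hf Hc Hfx Hlsc.
  set (g := fun y => proj1_sig (constructive_indefinite_description _ (nearest_point_exists x y Hx))).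
  assert (Hg : forall y s, vnorm (y -v g y *v x) <= vnorm (y -v s *v x)).
  { intros y. unfold g. destruct constructive_indefinite_description; trivial. }
  clearbody g.
  assert (Hcv : forall y, Un_cv (fun n => f n y) (g y)).
  { intros y. apply (nearest_point_cv x y _ v); trivial. intros n; apply Hf. }
  exists g. split; [split; [split|]|split].
  - intros y z. apply (UL_sequence (fun n => f n (y +v z))); trivial.
    apply Un_cv_ext_eq with (fun n => f n y + f n z).
    { intros n. symmetry. apply lin_add, Hf. }
    apply CV_plus; trivial.
  - intros a y. apply (UL_sequence (fun n => f n (a *v y))); trivial.
    apply Un_cv_ext_eq with (fun n => a * f n y).
    { intros n. symmetry. apply lin_scal, Hf. }
    apply CV_mult; trivial. apply Un_cv_const.
  - intros y. apply (Un_cv_abs_le (fun n => f n y)); trivial. intros n. apply Hf.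
  - apply (UL_sequence (fun n => f n x)); trivial.
  - intros y. specialize (Hg y 0). replace (y -v 0 *v x) with y in Hg by vec. trivial.
Qed.

(** Either every orthogonal pair of nonzero vectors has a common nonzero orthogonal vector, or some
    orthogonal pair has trivial common kernel and therefore spans. Only in the second case is
    density of the orbit requested. *)
Lemma hilbert_of_bicontractive {X : Banach} (e : X) (f : X -> R) :
  vnorm e = 1 -> bicontractive_at e f -> strictly_convex X ->
  (forall x : X, vnorm x = 1 -> exists g, bicontractive_at x g) ->
  ((exists h, f h = 0 /\ h <> vzero /\ forall x, exists s t, x = s *v e +v t *v h) ->
    forall w : X, vnorm w = 1 -> forall eps, 0 < eps ->
    exists T S, inverse_isometries T S /\ vnorm (w -v T e) < eps) ->
  is_hilbert X.
Proof.
  intros He [[Lf Bf] [Ef Cf]] SC Hall Hdense.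
  destruct (orthogonality_form_exists Hall) as [B HB].
  pose proof (proj1 HB) as Blin. pose proof (proj1 (proj2 HB)) as Bself.
  destruct (classic (forall x y : X, B x y = 0 -> x <> vzero -> y <> vzero ->
    exists z, z <> vzero /\ B x z = 0 /\ B y z = 0)) as [Hdim|Hdim].
  { apply (hilbert_of_orthogonality_form B); trivial. }
  assert (Hp : exists x y, B x y = 0 /\ x <> vzero /\ y <> vzero /\
    forall z, B x z = 0 -> B y z = 0 -> z = vzero).
  { apply NNPP; intros HN. apply Hdim. intros x y Exy Hx Hy.
    apply NNPP; intros HN'. apply HN. exists x, y. repeat split; trivial.
    intros z E1 E2. apply NNPP; intros Hz. apply HN'. exists z; auto. }
  destruct Hp as [x [y [Exy [Hx [Hy Hz]]]]].
  pose proof (form_sym0 B HB SC _ _ Exy) as Eyx.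
  apply norm_pos in Hx. apply norm_pos in Hy.
  assert (Hspan : forall w, exists c d, w = c *v x +v d *v y).
  { intros w. exists (B x w / vnorm x ^ 2), (B y w / vnorm y ^ 2).
    apply vsub_eq0. apply Hz.
    - lin (Blin x). rewrite Bself, Exy. field; lra.
    - lin (Blin y). rewrite Bself, Eyx. field; lra. }
  (* Up to a factor, the only combination of [x] and [y] killed by [f]; with [e] it forms a basis
     whose coordinate projections are contractive. *)
  set (h := f y *v x -v f x *v y).
  assert (Hfxy : f x <> 0 \/ f y <> 0).
  { apply NNPP; intros HN. destruct (Hspan e) as [c [d E]].
    rewrite E in Ef. revert Ef. lin Lf. intros Ef.
    destruct (Req_dec (f x) 0) as [Ex|Ex]; [|tauto].
    destruct (Req_dec (f y) 0) as [Ey|Ey]; [|tauto].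
    rewrite Ex, Ey in Ef. lra. }
  assert (Hfh : f h = 0) by (unfold h; lin Lf; ring).
  assert (Hh : h <> vzero).
  { intros E. pose proof (f_equal (B x) E) as E1. pose proof (f_equal (B y) E) as E2.
    unfold h in E1, E2. revert E1 E2. lin (Blin x). lin (Blin y).
    rewrite !Bself, Exy, Eyx. intros E1 E2. destruct Hfxy as [H|H]; apply H.
    - apply (Rmult_eq_reg_r (vnorm y ^ 2)); [lra|nra].
    - apply (Rmult_eq_reg_r (vnorm x ^ 2)); [lra|nra]. }
  assert (Hbasis : forall w, exists s t, w = s *v e +v t *v h).
  { intros w. destruct (Hspan (w -v f w *v e)) as [c [d E]].
    assert (E0 : c * f x + d * f y = 0).
    { pose proof (f_equal f E) as E0. revert E0. lin Lf. rewrite Ef. lra. }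
    assert (Ht : exists t, c *v x +v d *v y = t *v h).
    { destruct Hfxy as [H|H].
      - exists (- d / f x). unfold h. vec.
        apply (Rmult_eq_reg_r (f x)); trivial.
        replace ((1 * c + 0 * d) * f x) with (c * f x) by ring. field_simplify; trivial. lra.
      - exists (c / f y). unfold h. vec.
        apply (Rmult_eq_reg_r (f y)); trivial. field_simplify; trivial. lra. }
    destruct Ht as [t Ht]. exists (f w), t. rewrite <- Ht, <- E. vec. }
  apply (hilbert_of_dense_orbit_plane e h He Hh Hbasis).
  - intros s t. specialize (Bf (s *v e +v t *v h)). revert Bf. lin Lf.
    rewrite Ef, Hfh. replace (s * 1 + t * 0) with s by ring. trivial.
  - intros s t. rewrite <- vnorm_scal. specialize (Cf (s *v e +v t *v h)).
    revert Cf. lin Lf. rewrite Ef, Hfh.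
    replace (s *v e +v t *v h -v (s * 1 + t * 0) *v e) with (t *v h) by vec. trivial.
  - apply Hdense. exists h; auto.
Qed.

(** * Orbits *)

Lemma surj_lin_isometry_inverse {X : Banach} (T : X -> X) :
  surj_lin_isometry T -> exists S, inverse_isometries T S.
Proof.
  intros [[T1 T2] [T3 T4]].
  set (S := fun y => proj1_sig (constructive_indefinite_description _ (T4 y))).
  assert (HS : forall y, T (S y) = y).
  { intros y. unfold S. destruct constructive_indefinite_description; trivial. }
  assert (Hinj : forall x y, T x = T y -> x = y).
  { intros x y E. apply vsub_eq0, vnorm_eq0.
    rewrite <- T3. unfold vsub. rewrite vopp_scal, T1, T2, E, <- vopp_scal, vadd_opp.
    apply norm_zero. }
  exists S. repeat split; auto.
  - intros x y. apply Hinj. rewrite T1, !HS; trivial.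
  - intros a x. apply Hinj. rewrite T2, !HS; trivial.
  - intros x. rewrite <- T3, HS; trivial.
Qed.

Lemma linear_op_sub {X : Banach} (T : X -> X) x y :
  linear_op T -> T (x -v y) = T x -v T y.
Proof.
  intros [T1 T2]. unfold vsub. rewrite T1, vopp_scal, T2, <- vopp_scal. trivial.
Qed.

Lemma dual_ball_comp {X : Banach} (T : X -> X) (f : X -> R) :
  lin_isometry T -> dual_ball f -> dual_ball (fun x => f (T x)).
Proof.
  intros [[T1 T2] T3] [[F1 F2] F3]. split; [split|].
  - intros x y. rewrite T1, F1; trivial.
  - intros a x. rewrite T2, F2; trivial.
  - intros x. rewrite <- T3. apply F3.
Qed.

Lemma bicontractive_at_orbit {X : Banach} (T S : X -> X) (u : X) (f : X -> R) :
  inverse_isometries T S -> bicontractive_at u f ->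
  bicontractive_at (T u) (fun x => f (S x)).
Proof.
  intros [[LT NT] [HS [TS ST]]] [Hf [E C]].
  split; [|split].
  - apply dual_ball_comp; trivial.
  - rewrite ST; trivial.
  - intros y. specialize (C (S y)). rewrite (proj2 HS) in C.
    rewrite <- NT in C. rewrite linear_op_sub, TS in C by trivial.
    rewrite (proj2 LT) in C. trivial.
Qed.

Lemma hilbert_of_dense_orbit {X : Banach} (u : X) (f : X -> R) :
  vnorm u = 1 -> bicontractive_at u f -> strictly_convex X ->
  (forall x : X, vnorm x = 1 -> forall eps, 0 < eps ->
    exists T S, inverse_isometries T S /\ vnorm (x -v T u) < eps) ->
  is_hilbert X.
Proof.
  intros Hu Hf SC Hd. apply (hilbert_of_bicontractive u f); trivial.
  intros x Hx.
  assert (H : forall n, exists TS : (X -> X) * (X -> X),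
    inverse_isometries (fst TS) (snd TS) /\ vnorm (x -v fst TS u) < / (INR n + 1)).
  { intros n. destruct (Hd x Hx (/ (INR n + 1))) as [T [S H]].
    { apply Rinv_0_lt_compat. pose proof (pos_INR n). lra. }
    exists (T, S); trivial. }
  set (TS := fun n => proj1_sig (constructive_indefinite_description _ (H n))).
  assert (HTS : forall n, inverse_isometries (fst (TS n)) (snd (TS n)) /\
    vnorm (x -v fst (TS n) u) < / (INR n + 1)).
  { intros n. unfold TS. destruct constructive_indefinite_description; trivial. }
  clearbody TS. clear H.
  assert (Hcv : forall eps, 0 < eps -> exists N, forall n, (n >= N)%nat ->
    vnorm (x -v fst (TS n) u) < eps).
  { intros eps He. destruct (inv_succ_small eps He) as [N HN]. exists N. intros n Hn.
    apply Rlt_trans with (1 := proj2 (HTS n)). auto. }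
  assert (Hb : forall n, bicontractive_at (fst (TS n) u) (fun y => f (snd (TS n) y))).
  { intros n. apply bicontractive_at_orbit; trivial. apply HTS. }
  apply (bicontractive_limit x (fun n => fst (TS n) u) (fun n y => f (snd (TS n) y)));
    trivial; try (intros n; apply Hb).
  - intros eps He. destruct (Hcv eps He) as [N HN]. exists N. intros n Hn.
    specialize (HN n Hn). destruct (Hb n) as [[L BL] [E _]]. unfold R_dist.
    rewrite <- E. rewrite <- (lin_sub _ _ _ L). eapply Rle_lt_trans; [apply BL|trivial].
  - intros y s eps He. destruct (Hcv (eps / (Rabs s + 1))) as [N HN].
    { apply Rdiv_lt_0_compat; trivial. pose proof (Rabs_pos s); lra. }
    exists N. intros n Hn. specialize (HN n Hn).
    assert (vnorm (y -v s *v x) <= vnorm (y -v s *v fst (TS n) u) +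
      vnorm (s *v (fst (TS n) u -v x))) by (apply norm_le_add; vec).
    rewrite vnorm_scal, (norm_sub_sym _ x) in H.
    pose proof (Rabs_pos s). pose proof (norm_ge0 (x -v fst (TS n) u)).
    apply (Rmult_lt_compat_r (Rabs s + 1)) in HN; [|lra].
    replace (eps / (Rabs s + 1) * (Rabs s + 1)) with eps in HN by (field; lra). nra.
Qed.

(** Jensen's inequality for [p ||v + z|| + g v]. Partial sums of weights are not 1, so [z] is scaled
    by their sum to let the induction pass. *)
Lemma vsum_convex_le {X : Banach} p (z : X) (g : X -> R) c n (l : nat -> R) (v : nat -> X) :
  0 <= p -> lin_functional g ->
  (forall i, (i < n)%nat -> 0 <= l i /\ p * vnorm (v i +v z) + g (v i) <= c) ->
  let s := vsum n (fun i => l i *v v i) in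
  p * vnorm (s +v rsum n l *v z) + g s <= rsum n l * c.
Proof.
  intros Hp Lg. induction n as [|n IH]; intros H; simpl.
  - rewrite (lin_zero _ Lg). replace (vzero +v 0 *v z) with (@vzero X) by vec.
    rewrite norm_zero. lra.
  - specialize (IH (fun i Hi => H i (Nat.lt_lt_succ_r _ _ Hi))). simpl in IH.
    destruct (H n (Nat.lt_succ_diag_r n)) as [H1 H2].
    set (s := vsum n (fun i => l i *v v i)) in *. lin Lg.
    assert (Hn : vnorm (s +v l n *v v n +v (rsum n l + l n) *v z) <=
      vnorm (s +v rsum n l *v z) + l n * vnorm (v n +v z)).
    { rewrite <- (Rabs_right (l n)) at 3 by lra. rewrite <- vnorm_scal.
      apply norm_le_add. vec. }
    apply (Rmult_le_compat_l p) in Hn; trivial.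
    apply (Rmult_le_compat_l (l n)) in H2; trivial. lra.
Qed.

(** A Lipschitz convex function bounded on the orbit obeys the same bound on its closed convex hull,
    the ball. The family with [p], [z] and [g] covers linear functionals, distances, and a distance
    plus a penalty. *)
Lemma big_point_le {X : Banach} (u : X) p (z : X) (g : X -> R) K c :
  big_point u -> 0 <= p -> lin_functional g -> (forall x, g x <= K * vnorm x) ->
  (forall T, surj_lin_isometry T -> p * vnorm (T u +v z) + g (T u) <= c) ->
  forall y, ball X y -> p * vnorm (y +v z) + g y <= c.
Proof.
  intros [_ Hbig] Hp Lg Hg H y Hy. apply Hbig in Hy.
  assert (HK : 0 < p + Rabs K + 1) by (pose proof (Rabs_pos K); lra).
  apply Rnot_lt_le; intros Hlt.
  set (gap := p * vnorm (y +v z) + g y - c).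
  destruct (Hy (gap / (p + Rabs K + 1))) as [w [[n [l [v [Hv [El Ew]]]]] Hyw]].
  { apply Rdiv_lt_0_compat; trivial. unfold gap; lra. }
  assert (Hw : p * vnorm (w +v z) + g w <= c).
  { pose proof (vsum_convex_le p z g c n l v Hp Lg) as Hc. simpl in Hc.
    rewrite El, Rmult_1_l, vscal_1, <- Ew in Hc. apply Hc.
    intros i Hi. destruct (Hv i Hi) as [H0 [T [HT ->]]]. split; auto. }
  apply (Rmult_lt_compat_r (p + Rabs K + 1)) in Hyw; trivial.
  replace (gap / (p + Rabs K + 1) * (p + Rabs K + 1)) with gap in Hyw by (field; lra).
  assert (Hn : vnorm (y +v z) <= vnorm (w +v z) + vnorm (y -v w)) by (apply norm_le_add; vec).
  apply (Rmult_le_compat_l p) in Hn; trivial.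
  assert (Hgg : g y <= g w + Rabs K * vnorm (y -v w)).
  { specialize (Hg (y -v w)). revert Hg. lin Lg. intros Hg.
    pose proof (Rle_abs K). pose proof (norm_ge0 (y -v w)). nra. }
  pose proof (norm_ge0 (y -v w)). unfold gap in Hyw. nra.
Qed.

Lemma big_point_functional {X : Banach} (u : X) (g : X -> R) K c x :
  big_point u -> lin_functional g -> (forall x, g x <= K * vnorm x) ->
  ball X x -> c < g x ->
  exists T, surj_lin_isometry T /\ c < g (T u).
Proof.
  intros Hbig Lg Hg Hx Hc. apply NNPP; intros HN.
  assert (0 * vnorm (x +v vzero) + g x <= c); [|lra].
  apply (big_point_le u 0 vzero g K c); trivial; [lra|].
  intros T HT. apply Rnot_lt_le; intros Hlt. apply HN. exists T; split; trivial. lra.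
Qed.

(** The convex function [||y + x||] reaches 2 at [y = x], so it cannot stay below [2 - d] on the
    orbit. *)
Lemma big_point_add {X : Banach} (u x : X) d :
  big_point u -> vnorm x = 1 -> 0 < d ->
  exists T, surj_lin_isometry T /\ 2 - d < vnorm (T u +v x).
Proof.
  intros Hbig Hx Hd. apply NNPP; intros HN.
  assert (1 * vnorm (x +v x) + 0 <= 2 - d).
  { apply (big_point_le u 1 x (fun _ => 0) 0 (2 - d)); trivial.
    - lra.
    - split; intros; ring.
    - intros; lra.
    - intros T HT. apply Rnot_lt_le; intros Hlt. apply HN. exists T; split; trivial. lra.
    - unfold ball; lra. }
  replace (x +v x) with (2 *v x) in H by vec.
  rewrite vnorm_scal, Hx, Rabs_right in H; lra.
Qed.

(** * Almost supporting pairs of bicontractive functionals *)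

Lemma bernoulli_one_minus h n : 0 <= h <= 1 -> 1 - INR n * h <= (1 - h) ^ n.
Proof.
  intros Hh. induction n as [|n IH]; [simpl; lra|].
  rewrite S_INR. simpl pow. pose proof (pos_INR n).
  assert (0 <= INR n * (h * h)) by (apply Rmult_le_pos; nra). nra.
Qed.

Lemma geometric_ge k n : 0 <= k <= 1 -> INR n * k ^ n <= rsum n (pow k).
Proof.
  intros Hk. induction n as [|n IH]; [simpl; lra|].
  rewrite S_INR. simpl pow. simpl rsum.
  assert (0 <= k ^ n) by (apply pow_le; lra). pose proof (pos_INR n).
  assert (0 <= INR n * k ^ n) by (apply Rmult_le_pos; trivial). nra.
Qed.

(* Alternating the contractions [x |-> x - f(x) v] and [x |-> x - g(x) w]
   moves [x] by multiples of the fixed vector [w - f(w) v]. *)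
Lemma alternating_contractions {X : Banach} (v w : X) (f g : X -> R) x n :
  bicontractive_at v f -> bicontractive_at w g -> f x = 0 ->
  Rabs (g x) * vnorm (w -v f w *v v) * Rabs (rsum n (pow (f w * g v))) <= 2 * vnorm x.
Proof.
  intros [[Lf Bf] [Ef Cf]] [[Lg Bg] [Eg Cg]] Hx.
  set (k := f w * g v). set (d := w -v f w *v v).
  (* Closed form of the iterate after [n] rounds: as [g d = 1 - k], each round multiplies [g] by
     [k], and the displacements along [d] sum to a geometric series. *)
  set (y := fun n => x -v (g x * rsum n (pow k)) *v d).
  assert (Hd : f d = 0 /\ g d = 1 - k).
  { unfold d, k. lin Lf. lin Lg. rewrite Ef, Eg. split; ring. }
  assert (Hy : f (y n) = 0 /\ g (y n) = g x * k ^ n /\ vnorm (y n) <= vnorm x).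
  { induction n as [|m [H1 [H2 H3]]].
    - unfold y. simpl. replace (x -v (g x * 0) *v d) with x by vec.
      repeat split; trivial; [ring|lra].
    - assert (E : y (S m) = y m -v g (y m) *v w -v f (y m -v g (y m) *v w) *v v).
      { lin Lf. rewrite H1, H2. unfold y, d. simpl rsum. vec. }
      split; [|split].
      + unfold y. lin Lf. destruct Hd as [-> _]. rewrite Hx. ring.
      + assert (Hstep : g (y (S m)) = g (y m) - g x * k ^ m * (1 - k)).
        { destruct Hd as [_ <-]. unfold y. simpl rsum. lin Lg. ring. }
        rewrite Hstep, H2. simpl. ring.
      + rewrite E. eapply Rle_trans; [apply Cf|].
        eapply Rle_trans; [apply Cg|trivial]. }
  destruct Hy as [_ [_ Hy]].
  replace (Rabs (g x) * vnorm d * Rabs (rsum n (pow k)))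
    with (vnorm ((g x * rsum n (pow k)) *v d))
    by (rewrite vnorm_scal, Rabs_mult; ring).
  replace ((g x * rsum n (pow k)) *v d) with (x -v y n) by (unfold y; vec).
  eapply Rle_trans; [apply norm_sub_le|]. lra.
Qed.

Lemma almost_supporting_pair (e : R) : 0 < e ->
  exists h, 0 < h /\ forall (X : Banach) (v w : X) (f g : X -> R),
  vnorm v = 1 -> vnorm w = 1 -> bicontractive_at v f -> bicontractive_at w g ->
  1 - h < f w -> 1 - h < g v ->
  forall y, vnorm y <= 1 -> Rabs (g y - f y) * vnorm (w -v v) <= e.
Proof.
  intros He.
  (* With [h <= 1 / (4 n)] the geometric sum stays above [n / 2], so the product from the
     alternating contractions is at most [4 / n < e / 2]. The bound [h <= e / 10] absorbs the errors
     from replacing [f w] and [g v] by 1. *)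
  destruct (pos_INR_unbounded (8 / e)) as [n [Hn Hn0]].
  assert (Hn1 : 1 <= INR n) by (change 1 with (INR 1); apply le_INR; lia).
  set (h := Rmin (/ (4 * INR n)) (e / 10)).
  assert (Hh : 0 < h /\ h <= / (4 * INR n) /\ h <= e / 10).
  { unfold h. split; [apply Rmin_glb_lt|split; [apply Rmin_l|apply Rmin_r]]; [|lra].
    apply Rinv_0_lt_compat; lra. }
  clearbody h. exists h. split; [tauto|].
  intros X v w f g Hv Hw Hf Hg Ha Hb y Hy.
  destruct Hh as [Hh0 [Hh1 Hh2]].
  assert (Hhn : INR n * (2 * h) <= / 2).
  { apply (Rmult_le_compat_l (2 * INR n)) in Hh1; [|lra].
    replace (2 * INR n * / (4 * INR n)) with (/ 2) in Hh1 by (field; lra). lra. }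
  assert (Hhs : h <= / 4) by nra.
  pose proof Hf as [[Lf Bf] [Ef Cf]]. pose proof Hg as [[Lg Bg] [Eg Cg]].
  set (a := f w) in *. set (b := g v) in *.
  assert (Ha1 : a <= 1).
  { unfold a. rewrite <- Hw. apply dual_ball_le; split; trivial. }
  assert (Hb1 : b <= 1).
  { unfold b. rewrite <- Hv. apply dual_ball_le; split; trivial. }
  set (x := y -v f y *v v).
  assert (Hfx : f x = 0) by (unfold x; lin Lf; rewrite Ef; ring).
  assert (Hgx : g x = g y - f y * b) by (unfold x, b; lin Lg; ring).
  assert (Hxn : vnorm x <= 1) by (eapply Rle_trans; [apply Cf|trivial]).
  pose proof (alternating_contractions v w f g x n Hf Hg Hfx) as K.
  fold a b in K.
  assert (Hk : 1 - 2 * h <= a * b <= 1) by (split; nra).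
  assert (Hs : INR n / 2 <= rsum n (pow (a * b))).
  { apply Rle_trans with (INR n * (a * b) ^ n); [|apply geometric_ge; lra].
    assert (/ 2 <= (a * b) ^ n); [|nra].
    apply Rle_trans with ((1 - 2 * h) ^ n); [|apply pow_incr; lra].
    pose proof (bernoulli_one_minus (2 * h) n). lra. }
  set (c := Rabs (g x)) in *. set (m := vnorm (w -v a *v v)) in *.
  assert (Hc0 : 0 <= c) by apply Rabs_pos.
  assert (Hm0 : 0 <= m) by apply norm_ge0.
  rewrite Rabs_right in K by lra.
  assert (Hcm : c * m <= e / 2).
  { assert (Hcm0 : 0 <= c * m) by (apply Rmult_le_pos; trivial).
    assert (c * m * (INR n / 2) <= 2) by nra.
    assert (8 < INR n * e).
    { apply (Rmult_lt_compat_r e) in Hn; trivial.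
      replace (8 / e * e) with 8 in Hn by (field; lra). trivial. }
    nra. }
  assert (Hc1 : c <= 1).
  { unfold c. eapply Rle_trans; [apply Bg|trivial]. }
  assert (Hm1 : m <= 2).
  { unfold m. eapply Rle_trans; [apply norm_sub_le|].
    rewrite vnorm_scal, Hv, Hw, Rabs_right; lra. }
  assert (H1 : Rabs (g y - f y) <= c + h).
  { replace (g y - f y) with (g x + - (f y * (1 - b))) by (rewrite Hgx; ring).
    eapply Rle_trans; [apply Rabs_triang|]. apply Rplus_le_compat_l.
    rewrite Rabs_Ropp, Rabs_mult, (Rabs_right (1 - b)) by lra.
    specialize (Bf y). pose proof (Rabs_pos (f y)). nra. }
  assert (H2 : vnorm (w -v v) <= m + h).
  { apply Rle_trans with (m + vnorm ((1 - a) *v v)).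
    - unfold m.
      rewrite (norm_sub_sym w (a *v v)). rewrite (norm_sub_sym w v).
      replace (v -v w) with (a *v v -v w +v (1 - a) *v v) by vec. apply vnorm_triangle.
    - rewrite vnorm_scal, Hv, Rabs_right; lra. }
  pose proof (Rabs_pos (g y - f y)). pose proof (norm_ge0 (w -v v)).
  apply Rle_trans with ((c + h) * (m + h)).
  - apply Rmult_le_compat; trivial.
  - nra.
Qed.

(** * The local hypothesis at [u] *)

Lemma projection_functional {X : Banach} (u : X) (P : X -> X) :
  vnorm u = 1 -> projection_onto_span P u -> bicontractive P ->
  exists f, bicontractive_at u f /\ forall x, P x = f x *v u.
Proof.
  intros Hu [[P1 P2] [PP HP]] [C1 C2].
  assert (Hf : forall x, exists t, P x = t *v u).
  { intros x. apply HP. exists x; trivial. }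
  set (f := fun x => proj1_sig (constructive_indefinite_description _ (Hf x))).
  assert (Ef : forall x, P x = f x *v u).
  { intros x. unfold f. destruct constructive_indefinite_description; trivial. }
  clearbody f. exists f.
  assert (Hinj : forall s t, s *v u = t *v u -> s = t).
  { intros s t E. apply Rminus_diag_uniq, (vscal_eq0 _ u).
    - replace ((s - t) *v u) with (s *v u -v t *v u) by vec. rewrite E. vec.
    - intros E0. rewrite E0, norm_zero in Hu. lra. }
  assert (Eu : P u = u).
  { destruct (proj2 (HP u)) as [x <-]; [exists 1; vec|apply PP]. }
  split; [|trivial]. split; [split; [split|]|split].
  - intros x y. apply Hinj. rewrite <- Ef, P1, !Ef. vec.
  - intros a x. apply Hinj. rewrite <- Ef, P2, !Ef. vec.
  - intros x. specialize (C1 x). rewrite Ef, vnorm_scal, Hu in C1. lra.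
  - apply Hinj. rewrite <- Ef, Eu. vec.
  - intros y. rewrite <- Ef. apply C2.
Qed.

(** The sequential condition is turned into a modulus [d], because one and the same [d] has to serve
    at all points of the orbit. *)
Lemma cond_a_uniform {X : Banach} (u : X) (P : X -> X) (f : X -> R) :
  vnorm u = 1 -> (forall x, P x = f x *v u) -> cond_a u P ->
  forall eps, 0 < eps -> exists d, 0 < d /\
  forall x, vnorm x <= 1 -> 2 - d < vnorm (u +v x) -> 1 - eps < f x.
Proof.
  intros Hu Ef Ha eps He. apply NNPP; intros HN.
  assert (H : forall n, exists x, vnorm x <= 1 /\ 2 - / (INR n + 1) < vnorm (u +v x) /\
    f x <= 1 - eps).
  { intros n. apply NNPP; intros HN'. apply HN. exists (/ (INR n + 1)). split.
    { apply Rinv_0_lt_compat. pose proof (pos_INR n). lra. }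
    intros x H1 H2. apply Rnot_le_lt; intros H3. apply HN'. exists x; auto. }
  set (xs := fun n => proj1_sig (constructive_indefinite_description _ (H n))).
  assert (Hxs : forall n, vnorm (xs n) <= 1 /\ 2 - / (INR n + 1) < vnorm (u +v xs n) /\
    f (xs n) <= 1 - eps).
  { intros n. unfold xs. destruct constructive_indefinite_description; trivial. }
  clearbody xs.
  destruct (Ha xs (fun n => proj1 (Hxs n))) with (eps := eps) as [N HN']; trivial.
  - intros e He'. destruct (inv_succ_small e He') as [n Hn]. exists n. intros m Hm.
    specialize (Hn m Hm). destruct (Hxs m) as [H1 [H2 _]]. unfold R_dist.
    pose proof (vnorm_triangle X u (xs m)) as T.
    rewrite Rabs_minus_sym, Rabs_right by lra. lra.
  - specialize (HN' N (le_n N)). destruct (Hxs N) as [_ [_ H3]].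
    rewrite Ef in HN'. unfold R_dist in HN'. rewrite Rminus_0_r in HN'.
    replace (f (xs N) *v u -v u) with ((f (xs N) - 1) *v u) in HN' by vec.
    rewrite vnorm_scal, Hu, Rmult_1_r, Rabs_Rabsolu in HN'.
    apply Rabs_def2 in HN'. lra.
Qed.

Lemma inverse_isometries_norm_add {X : Banach} (T S : X -> X) x y :
  inverse_isometries T S -> vnorm (T x +v y) = vnorm (x +v S y).
Proof.
  intros [[[T1 _] NT] [_ [TS _]]]. rewrite <- (NT (x +v S y)), T1, TS. trivial.
Qed.

Section Orbit.
Context {X : Banach} (u : X) (f : X -> R).
Context (Hbig : big_point u) (Hf : bicontractive_at u f).
Context (Ha : forall eps, 0 < eps -> exists d, 0 < d /\
  forall x, vnorm x <= 1 -> 2 - d < vnorm (u +v x) -> 1 - eps < f x).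

Let Hu : vnorm u = 1 := proj1 Hbig.
Let Lf : lin_functional f := proj1 (proj1 Hf).
Let Ef : f u = 1 := proj1 (proj2 Hf).

Let f_le x : f x <= vnorm x := dual_ball_le f x (proj1 Hf).

Let Ha_orbit eps : 0 < eps -> exists d, 0 < d /\
  forall T S x, inverse_isometries T S -> vnorm x <= 1 ->
  2 - d < vnorm (T u +v x) -> 1 - eps < f (S x).
Proof.
  intros He. destruct (Ha eps He) as [d [Hd H]]. exists d. split; trivial.
  intros T S x HTS Hx Hn. apply H.
  - rewrite (proj2 (proj1 (proj2 HTS))). trivial.
  - rewrite <- (inverse_isometries_norm_add T S) by trivial. trivial.
Qed.

Lemma hilbert_of_strongly_exposed_orbit :
  (forall eps, 0 < eps -> exists d, 0 < d /\ forall T, surj_lin_isometry T ->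
    1 - d < f (T u) -> vnorm (T u -v u) < eps) ->
  is_hilbert X.
Proof.
  intros HI.
  assert (Hexp : forall eps, 0 < eps -> exists d, 0 < d /\ forall y, vnorm y <= 1 ->
    1 - d < f y -> vnorm (y -v u) < eps).
  { intros eps He. destruct (HI (eps / 2)) as [d [Hd H]]; [lra|].
    exists (eps * d / 4). split; [nra|]. intros y Hy Hfy.
    (* The slope [2 / d] is a penalty: where [f (T u) <= 1 - d] it costs at least 2, the largest
       possible value of [||T u - u||]. The bound thus holds on the orbit and extends to the ball by
       convexity. *)
    assert (K : 1 * vnorm (y +v vopp u) + 2 / d * f y <= eps / 2 + 2 / d).
    { apply (big_point_le u 1 (vopp u) (fun y => 2 / d * f y) (2 / d)); trivial.
      - lra.
      - split; intros; lin Lf; ring.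
      - intros x. apply Rmult_le_compat_l; [|apply f_le].
        apply Rlt_le, Rdiv_lt_0_compat; lra.
      - intros T HT. fold (T u -v u).
        assert (NT : vnorm (T u) = 1) by (rewrite (proj1 (proj2 HT)); trivial).
        pose proof (f_le (T u)) as FT. rewrite NT in FT.
        assert (D2 : 0 < 2 / d) by (apply Rdiv_lt_0_compat; lra).
        destruct (Rlt_dec (1 - d) (f (T u))) as [HL|HL].
        + specialize (H T HT HL). nra.
        + pose proof (norm_sub_le (T u) u) as N. rewrite NT, Hu in N.
          assert (2 / d * f (T u) <= 2 / d * (1 - d)) by (apply Rmult_le_compat_l; lra).
          replace (2 / d * (1 - d)) with (2 / d - 2) in * by (field; lra). lra. }
    fold (y -v u) in K.
    assert (2 / d * (1 - f y) < eps / 2).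
    { replace (eps / 2) with (2 / d * (eps * d / 4)) by (field; lra).
      apply Rmult_lt_compat_l; [|lra]. apply Rdiv_lt_0_compat; lra. }
    lra. }
  (* After transport by [S], condition (a) brings [f (S y)] close to 1, and strong exposure brings
     [S y] close to [u]. *)
  assert (Hlur : forall eps, 0 < eps -> exists d, 0 < d /\
    forall T S y, inverse_isometries T S -> vnorm y <= 1 ->
    2 - d < vnorm (T u +v y) -> vnorm (y -v T u) < eps).
  { intros eps He. destruct (Hexp eps He) as [d1 [Hd1 H1]].
    destruct (Ha_orbit d1 Hd1) as [d [Hd H]]. exists d. split; trivial.
    intros T S y HTS Hy Hn. specialize (H T S y HTS Hy Hn).
    destruct HTS as [[LT NT] [HS [TS ST]]].
    specialize (H1 (S y)). rewrite (proj2 HS) in H1. specialize (H1 Hy H).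
    rewrite <- NT, linear_op_sub, TS in H1 by trivial. trivial. }
  assert (Hdense : forall x : X, vnorm x = 1 -> forall eps, 0 < eps ->
    exists T S, inverse_isometries T S /\ vnorm (x -v T u) < eps).
  { intros x Hx eps He. destruct (Hlur eps He) as [d [Hd H]].
    destruct (big_point_add u x d Hbig Hx Hd) as [T [HT Hn]].
    destruct (surj_lin_isometry_inverse T HT) as [S HTS].
    exists T, S. split; trivial. apply (H T S); trivial. lra. }
  apply (hilbert_of_dense_orbit u f); trivial.
  intros x y Hx Hy Hxy. apply vsub_eq0, vnorm_eq0.
  apply (small_zero _ 2). intros eps He.
  rewrite Rabs_right by apply Rle_ge, norm_ge0.
  destruct (Hlur eps He) as [d [Hd H]].
  destruct (Hdense x Hx (Rmin eps d)) as [T [S [HTS Hn]]].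
  { apply Rmin_glb_lt; trivial. }
  pose proof (Rmin_l eps d). pose proof (Rmin_r eps d).
  specialize (H T S y HTS). rewrite norm_sub_sym in H.
  assert (vnorm (x +v y) <= vnorm (T u +v y) + vnorm (x -v T u)) by (apply norm_le_add; vec).
  assert (vnorm (T u -v y) < eps) by (apply H; lra).
  assert (vnorm (x -v y) <= vnorm (x -v T u) + vnorm (T u -v y)) by (apply norm_le_add; vec).
  lra.
Qed.

Let f_comp T S : inverse_isometries T S -> bicontractive_at (T u) (fun x => f (S x)).
Proof. intros HTS. apply bicontractive_at_orbit; trivial. Qed.

(* If the orbit does not accumulate only at [u] along [f], any [w] of the
   orbit with [f w] close to [1] is far from [u] or from some [v] with [f v]
   close to [1], and [almost_supporting_pair] compares the functionals. *)
Let functionals_converge :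
  ~ (forall eps, 0 < eps -> exists d, 0 < d /\ forall T, surj_lin_isometry T ->
    1 - d < f (T u) -> vnorm (T u -v u) < eps) ->
  forall eps, 0 < eps -> exists d, 0 < d /\ forall T S, inverse_isometries T S ->
    1 - d < f (T u) -> forall y, vnorm y <= 1 -> Rabs (f (S y) - f y) <= eps.
Proof.
  intros HN eps He.
  assert (Hc : exists c, 0 < c /\ forall d, 0 < d -> exists T, surj_lin_isometry T /\
    1 - d < f (T u) /\ c <= vnorm (T u -v u)).
  { apply NNPP; intros HN1. apply HN. intros c Hc. apply NNPP; intros HN2.
    apply HN1. exists c. split; trivial. intros d Hd. apply NNPP; intros HN3.
    apply HN2. exists d. split; trivial. intros T HT Hd'. apply Rnot_le_lt; intros Hle.
    apply HN3. exists T; auto. }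
  destruct Hc as [c [Hc Hfar]].
  destruct (almost_supporting_pair (eps * c / 4)) as [h [Hh Hpair]]; [nra|].
  destruct (Ha_orbit h Hh) as [d0 [Hd0 H0]].
  set (d := Rmin (d0 / 2) h).
  assert (Hd : 0 < d /\ d <= d0 / 2 /\ d <= h).
  { unfold d. split; [apply Rmin_glb_lt; lra|split; [apply Rmin_l|apply Rmin_r]]. }
  destruct Hd as [Hd [Hd1 Hd2]]. clearbody d.
  exists d. split; trivial. intros T S HTS HT y Hy.
  destruct (Hfar d Hd) as [T' [HT' [Hv Hvc]]].
  destruct (surj_lin_isometry_inverse T' HT') as [S' HTS'].
  assert (NT : vnorm (T u) = 1) by (rewrite (proj2 (proj1 HTS)); trivial).
  assert (NT' : vnorm (T' u) = 1) by (rewrite (proj2 (proj1 HTS')); trivial).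
  assert (Hsum : forall x z, f x + f z <= vnorm (x +v z)).
  { intros x z. rewrite <- (lin_add _ _ _ Lf). apply f_le. }
  (* [||A u + C u||] is at least [f (A u) + f (C u) > 2 - 2 d], and [2 d <= d0], so condition (a)
     transported to [A u] applies. *)
  assert (Swap : forall A B C D, inverse_isometries A B -> inverse_isometries C D ->
    1 - d < f (A u) -> 1 - d < f (C u) -> 1 - h < f (B (C u))).
  { intros A B C D HAB HCD H1 H2. apply (H0 A B); trivial.
    - rewrite (proj2 (proj1 HCD)). right; trivial.
    - specialize (Hsum (A u) (C u)). lra. }
  assert (Hid : inverse_isometries (fun x : X => x) (fun x => x)).
  { repeat split; trivial. }
  assert (Hfu : 1 - d < f u) by lra.
  assert (far : forall A B C D, inverse_isometries A B -> inverse_isometries C D ->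
    1 - d < f (A u) -> 1 - d < f (C u) -> c / 2 <= vnorm (C u -v A u) ->
    Rabs (f (D y) - f (B y)) <= eps / 2).
  { intros A B C D HAB HCD H1 H2 Hfa.
    assert (K : Rabs (f (D y) - f (B y)) * vnorm (C u -v A u) <= eps * c / 4).
    { apply (Hpair X (A u) (C u) (fun x => f (B x)) (fun x => f (D x))); trivial.
      - rewrite (proj2 (proj1 HAB)); trivial.
      - rewrite (proj2 (proj1 HCD)); trivial.
      - apply f_comp; trivial.
      - apply f_comp; trivial.
      - apply (Swap A B C D); trivial.
      - apply (Swap C D A B); trivial. }
    pose proof (Rabs_pos (f (D y) - f (B y))). nra. }
  destruct (Rle_dec (c / 2) (vnorm (T u -v u))) as [Hw|Hw].
  - pose proof (far _ _ _ _ Hid HTS Hfu HT Hw). lra.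
  - assert (Hwv : c / 2 <= vnorm (T' u -v T u)).
    { assert (vnorm (T' u -v u) <= vnorm (T' u -v T u) + vnorm (T u -v u))
        by (apply norm_le_add; vec). lra. }
    pose proof (far _ _ _ _ HTS HTS' HT Hv Hwv) as F1.
    assert (Hvu : c / 2 <= vnorm (T' u -v u)) by lra.
    pose proof (far _ _ _ _ Hid HTS' Hfu Hv Hvu) as F2. cbv beta in F2.
    replace (f (S y) - f y) with (f (S' y) - f y + - (f (S' y) - f (S y))) by ring.
    eapply Rle_trans; [apply Rabs_triang|]. rewrite Rabs_Ropp. lra.
Qed.

(** An orbit point almost aligned with [x] exists because [u] is big, and condition (a) says that
    its functional almost norms [x]. *)
Let norm_approx x t : 0 < t -> exists T S, inverse_isometries T S /\
  vnorm x * (1 - t) <= f (S x).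
Proof.
  intros Ht. destruct (classic (x = vzero)) as [->|Hx].
  { exists (fun x => x), (fun x => x). split; [repeat split; trivial|].
    rewrite norm_zero, (lin_zero _ Lf). lra. }
  destruct (Ha_orbit t Ht) as [d [Hd H]].
  pose proof (norm_normalize x Hx) as Hn.
  destruct (big_point_add u _ d Hbig Hn Hd) as [T [HT HTx]].
  destruct (surj_lin_isometry_inverse T HT) as [S HTS].
  exists T, S. split; trivial.
  specialize (H T S _ HTS (Req_le _ _ Hn) HTx).
  rewrite (proj2 (proj1 (proj1 (proj2 HTS)))), (lin_scal _ _ _ Lf) in H.
  apply norm_pos in Hx. apply Rlt_le in H.
  apply (Rmult_le_compat_l (vnorm x)) in H; [|lra].
  replace (vnorm x * (/ vnorm x * f (S x))) with (f (S x)) in H by (field; lra). trivial.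
Qed.

(** Norm convergence of the orbit functionals makes the norm Frechet smooth at [u], uniformly along
    the orbit. If [||g + f_n||] is close to 2, some orbit point almost norms both functionals, and
    smoothness there makes them close in norm. *)
Lemma dual_LUR_of_not_strongly_exposed :
  ~ (forall eps, 0 < eps -> exists d, 0 < d /\ forall T, surj_lin_isometry T ->
    1 - d < f (T u) -> vnorm (T u -v u) < eps) ->
  dual_wstar_LUR X.
Proof.
  intros HN. pose proof (functionals_converge HN) as Hcv.
  (* A Smulian-type argument: [l] is tested on [u + s z], whose norm is almost attained by some
     [f o S]. Then [f (S u)] is close to 1, hence by (a) so is [f (T u)], and [f o S] is close to
     [f]. Dividing by [s] leaves three errors of [eps / 3]. *)
  assert (Hfre : forall eps, 0 < eps -> exists d, 0 < d /\ forall l, dual_ball l ->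
    1 - d < l u -> forall z, vnorm z <= 1 -> l z - f z <= eps).
  { intros eps He. destruct (Hcv (eps / 3)) as [d1 [Hd1 H1]]; [lra|].
    destruct (Ha d1 Hd1) as [d2 [Hd2 H2]].
    set (s := Rmin 1 (d2 / 4)).
    assert (Hs : 0 < s /\ s <= 1 /\ s <= d2 / 4).
    { unfold s. split; [apply Rmin_glb_lt; lra|split; [apply Rmin_l|apply Rmin_r]]. }
    set (t := Rmin (s * (eps / 6)) (d2 / 4)).
    assert (Ht : 0 < t /\ t <= s * (eps / 6) /\ t <= d2 / 4).
    { unfold t. split; [apply Rmin_glb_lt; nra|split; [apply Rmin_l|apply Rmin_r]]. }
    clearbody s t. exists (s * (eps / 3)). split; [nra|].
    intros l Hl Hlu z Hz.
    destruct (norm_approx (u +v s *v z) t) as [T [S [HTS Hn]]]; [tauto|].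
    pose proof HTS as [[LT NT] [[[S1 S2] NS] [TS ST]]].
    rewrite S1, S2 in Hn. revert Hn. lin Lf. intros Hn.
    assert (B1 : vnorm (u +v s *v z) <= 1 + s).
    { eapply Rle_trans; [apply vnorm_triangle|]. rewrite vnorm_scal, Hu, Rabs_right by lra. nra. }
    assert (B2 : 1 - s <= vnorm (u +v s *v z)).
    { assert (vnorm u <= vnorm (u +v s *v z) + vnorm ((- s) *v z)) by (apply norm_le_add; vec).
      rewrite vnorm_scal, Rabs_left in H by lra. rewrite Hu in H. nra. }
    pose proof (f_le (S u)) as Fu. rewrite NS, Hu in Fu.
    pose proof (f_le (S z)) as Fz. rewrite NS in Fz.
    assert (HSu : 1 - d2 < f (S u)) by nra.
    assert (HTu : 1 - d1 < f (T u)).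
    { apply H2.
      - rewrite NT, Hu; lra.
      - rewrite vadd_comm, (inverse_isometries_norm_add T S) by trivial.
        pose proof (f_le (u +v S u)) as F. revert F. lin Lf. rewrite Ef. lra. }
    specialize (H1 T S HTS HTu z Hz). apply Rabs_le_inv in H1.
    pose proof (dual_ball_le l (u +v s *v z) Hl) as Hlz.
    rewrite (lin_add _ _ _ (proj1 Hl)), (lin_scal _ _ _ (proj1 Hl)) in Hlz.
    apply (Rmult_le_reg_l s); [tauto|]. nra. }
  (* Transport to [T u]: both functionals are compared with [f o S]. *)
  assert (Hclose : forall eps, 0 < eps -> exists d, 0 < d /\ forall g l,
    dual_ball g -> dual_ball l -> forall T, surj_lin_isometry T ->
    1 - d < g (T u) -> 1 - d < l (T u) -> forall x, Rabs (l x - g x) <= eps * vnorm x).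
  { intros eps He. destruct (Hfre (eps / 2)) as [d [Hd H]]; [lra|].
    exists d. split; trivial. intros g l Hg Hl T HT Hgu Hlu x.
    destruct (surj_lin_isometry_inverse T HT) as [S HTS].
    pose proof HTS as [HT' [[[S1 S2] NS] [TS ST]]].
    assert (K : forall x, vnorm x = 1 -> Rabs (l x - g x) <= eps).
    { intros z Hz.
      assert (Q : forall k, dual_ball k -> 1 - d < k (T u) -> Rabs (k z - f (S z)) <= eps / 2).
      { intros k Hk Hku.
        assert (Hk' : dual_ball (fun x => k (T x))) by (apply dual_ball_comp; trivial).
        assert (Hz' : vnorm (S z) <= 1) by (rewrite NS; lra).
        pose proof (H _ Hk' Hku (S z) Hz') as P1.
        rewrite <- norm_opp in Hz'.
        pose proof (H _ Hk' Hku _ Hz') as P2. revert P1 P2. cbv beta.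
        rewrite (lin_opp _ _ (proj1 Hk')), (lin_opp _ _ Lf), TS. intros.
        apply Rabs_le; lra. }
      pose proof (Q g Hg Hgu) as Q1. pose proof (Q l Hl Hlu) as Q2.
      replace (l z - g z) with (l z - f (S z) + - (g z - f (S z))) by ring.
      eapply Rle_trans; [apply Rabs_triang|]. rewrite Rabs_Ropp. lra. }
    destruct (classic (x = vzero)) as [->|Hx].
    { rewrite (lin_zero _ (proj1 Hl)), (lin_zero _ (proj1 Hg)), norm_zero, Rminus_diag, Rabs_R0.
      lra. }
    specialize (K _ (norm_normalize x Hx)). apply norm_pos in Hx.
    rewrite (lin_scal _ _ _ (proj1 Hl)), (lin_scal _ _ _ (proj1 Hg)) in K.
    replace (/ vnorm x * l x - / vnorm x * g x) with (/ vnorm x * (l x - g x)) in K by ring.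
    rewrite Rabs_mult, Rabs_right in K by (apply Rle_ge, Rlt_le, Rinv_0_lt_compat; trivial).
    apply (Rmult_le_compat_l (vnorm x)) in K; [|lra].
    replace (vnorm x * (/ vnorm x * Rabs (l x - g x))) with (Rabs (l x - g x)) in K
      by (field; lra). lra. }
  intros g fs [Lg Hg] Hfs a Hna Hcva x eps He.
  assert (Dg : dual_ball g).
  { split; trivial. intros z. rewrite <- (Rmult_1_l (vnorm z)).
    apply dual_norm_is_bound; trivial. }
  destruct (Hclose (eps / (2 * (vnorm x + 1)))) as [d [Hd H]].
  { apply Rdiv_lt_0_compat; trivial. pose proof (norm_ge0 x). lra. }
  destruct (Hcva d Hd) as [N HN']. exists N. intros n Hn. specialize (HN' n Hn).
  unfold R_dist in *. apply Rabs_def2 in HN'.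
  pose proof (Hfs n) as Dn.
  assert (Lh : lin_functional (fun x => g x + fs n x)).
  { split; intros; [rewrite (lin_add g), (lin_add (fs n))|rewrite (lin_scal g), (lin_scal (fs n))];
      trivial; try apply Dn; ring. }
  assert (Hz : exists z, ball X z /\ 2 - d < g z + fs n z).
  { apply NNPP; intros HN''. assert (a n <= 2 - d); [|lra].
    apply (Hna n). intros s [z [Hz ->]]. apply Rabs_le.
    assert (Q : forall z, ball X z -> g z + fs n z <= 2 - d).
    { intros y Hy. apply Rnot_lt_le; intros Hlt. apply HN''. exists y; auto. }
    split; [|auto].
    assert (Hz' : ball X (vopp z)) by (unfold ball; rewrite norm_opp; trivial).
    specialize (Q _ Hz'). rewrite (lin_opp _ _ Lg), (lin_opp _ _ (proj1 Dn)) in Q. lra. }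
  destruct Hz as [z [Hz Hgz]].
  destruct (big_point_functional u _ 2 (2 - d) z Hbig Lh) as [T [HT HTu]]; trivial.
  { intros y. pose proof (dual_ball_le _ y Dg). pose proof (dual_ball_le _ y Dn). lra. }
  pose proof (dual_ball_le _ (T u) Dg) as G1. pose proof (dual_ball_le _ (T u) Dn) as G2.
  rewrite (proj1 (proj2 HT)), Hu in G1, G2.
  assert (K : Rabs (fs n x - g x) <= eps / (2 * (vnorm x + 1)) * vnorm x).
  { apply (H g (fs n)) with (T := T); trivial; lra. }
  pose proof (norm_ge0 x).
  apply Rle_lt_trans with (1 := K).
  apply Rle_lt_trans with (eps / 2); [|lra].
  apply (Rmult_le_reg_r (2 * (vnorm x + 1))); [lra|].
  replace (eps / (2 * (vnorm x + 1)) * vnorm x * (2 * (vnorm x + 1))) with (eps * vnorm x)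
    by (field; lra). nra.
Qed.
End Orbit.

(** * The Hahn-Banach theorem for norming functionals *)

(* A graph of a linear functional of norm at most one on a subspace that is
   either empty or contains [(x0, ||x0||)]; domination by the norm makes it
   single-valued. *)
Definition dominated_graph {X : Banach} (x0 : X) (A : X * R -> Prop) : Prop :=
  (forall x a y b, A (x, a) -> A (y, b) -> A (x +v y, a + b)) /\
  (forall c x a, A (x, a) -> A (c *v x, c * a)) /\
  (forall x a, A (x, a) -> a <= vnorm x) /\
  (forall p, A p -> A (x0, vnorm x0)).

(** The empty chain has empty union, which is why [dominated_graph] admits the empty graph. *)
Lemma maximal_dominated_graph {X : Banach} (x0 : X) :
  exists A, dominated_graph x0 A /\
  forall B : X * R -> Prop, dominated_graph x0 B -> (forall p, A p -> B p) ->
  forall p, B p -> A p.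
Proof.
  destruct (@classical_sets.Zorn_bigcup (X * R) (@dominated_graph X x0)) as [A [HA Hmax]].
  - intros F HF Htot. split; [|split; [|split]].
    + intros x a y b [G HG Ga] [G' HG' Gb].
      destruct (Htot G G' HG HG') as [S|S].
      * exists G'; trivial. apply (HF G' HG'); trivial. apply S; trivial.
      * exists G; trivial. apply (HF G HG); trivial. apply S; trivial.
    + intros c x a [G HG Ga]. exists G; trivial. apply (HF G HG); trivial.
    + intros x a [G HG Ga]. apply (HF G HG); trivial.
    + intros p [G HG Gp]. exists G; trivial. apply (proj2 (proj2 (proj2 (HF G HG))) p); trivial.
  - exists A. split; trivial. intros B HB HAB p Hp. apply NNPP; intros Hn.
    apply (Hmax B); trivial. split; trivial. intros HBA. apply Hn, HBA, Hp.
Qed.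

Lemma maximal_graph_total {X : Banach} (x0 : X) (A : X * R -> Prop) :
  dominated_graph x0 A -> A (x0, vnorm x0) ->
  (forall B : X * R -> Prop, dominated_graph x0 B -> (forall p, A p -> B p) ->
    forall p, B p -> A p) ->
  forall x, exists a, A (x, a).
Proof.
  intros [Aadd [Ascal [Ale Aseed]]] A0 Hmax z.
  assert (Azero : A (vzero, 0)).
  { pose proof (Ascal 0 _ _ A0) as H. rewrite vscal_0, Rmult_0_l in H. trivial. }
  (* [k] is the value to be given to [z]: the least number compatible with domination on the side of
     negative multiples of [z]. [Kup] shows that it also suits positive ones. *)
  destruct (completeness (fun r => exists y b, A (y, b) /\ r = b - vnorm (y -v z)))
    as [k [Hk1 Hk2]].
  - exists (vnorm z). intros r [y [b [Hb ->]]]. apply Ale in Hb.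
    assert (vnorm y <= vnorm (y -v z) + vnorm z) by (apply norm_le_add; vec). lra.
  - exists (0 - vnorm (vzero -v z)), vzero, 0. auto.
  - assert (Klow : forall y b, A (y, b) -> b - vnorm (y -v z) <= k).
    { intros y b Hb. apply Hk1. exists y, b; auto. }
    assert (Kup : forall y b, A (y, b) -> k <= vnorm (y +v z) - b).
    { intros y b Hb. apply Hk2. intros r [y' [b' [Hb' ->]]].
      pose proof (Ale _ _ (Aadd _ _ _ _ Hb Hb')) as H.
      assert (vnorm (y +v y') <= vnorm (y +v z) + vnorm (y' -v z))
        by (apply norm_le_add; vec). lra. }
    exists k.
    apply (Hmax (fun p => exists y b t, A (y, b) /\ p = (y +v t *v z, b + t * k))).
    + split; [|split; [|split]].
      * intros x a x' a' [y [b [t [Hb E]]]] [y' [b' [t' [Hb' E']]]].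
        injection E as -> ->. injection E' as -> ->.
        exists (y +v y'), (b + b'), (t + t'). split; auto. f_equal; [vec|ring].
      * intros c x a [y [b [t [Hb E]]]]. injection E as -> ->.
        exists (c *v y), (c * b), (c * t). split; auto. f_equal; [vec|ring].
      * intros x a [y [b [t [Hb E]]]]. injection E as -> ->.
        destruct (Rtotal_order t 0) as [Ht|[Ht|Ht]].
        -- pose proof (Klow _ _ (Ascal (/ - t) _ _ Hb)) as K.
           replace (y +v t *v z) with ((- t) *v (/ - t *v y -v z)) by (vec; field; lra).
           rewrite vnorm_scal, Rabs_right by lra.
           apply (Rmult_le_compat_l (- t)) in K; [|lra].
           replace (- t * (/ - t * b - vnorm (/ - t *v y -v z)))
             with (b - - t * vnorm (/ - t *v y -v z)) in K by (field; lra). lra.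
        -- rewrite Ht. replace (y +v 0 *v z) with y by vec. apply Ale in Hb. lra.
        -- pose proof (Kup _ _ (Ascal (/ t) _ _ Hb)) as K.
           replace (y +v t *v z) with (t *v (/ t *v y +v z)) by (vec; field; lra).
           rewrite vnorm_scal, Rabs_right by lra.
           apply (Rmult_le_compat_l t) in K; [|lra].
           replace (t * (vnorm (/ t *v y +v z) - / t * b))
             with (t * vnorm (/ t *v y +v z) - b) in K by (field; lra). lra.
      * intros _ _. exists x0, (vnorm x0), 0. split; trivial. f_equal; [vec|ring].
    + intros [y b] Hb. exists y, b, 0. split; trivial. f_equal; [vec|ring].
    + exists vzero, 0, 1. split; trivial. f_equal; [vec|ring].
Qed.

Lemma norming_functional {X : Banach} (x0 : X) :
  exists f : X -> R, dual_ball f /\ f x0 = vnorm x0.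
Proof.
  destruct (maximal_dominated_graph x0) as [A [HA Hmax]].
  assert (A0 : A (x0, vnorm x0)).
  { apply (Hmax (fun p => A p \/ exists c, p = (c *v x0, c * vnorm x0))).
    - assert (HA' : forall p, A p -> exists q, A q) by eauto.
      destruct (classic (exists q, A q)) as [[q Hq]|Hempty].
      + pose proof HA as [Aadd [Ascal [Ale Aseed]]]. pose proof (Aseed q Hq) as A0.
        assert (E : forall p, (A p \/ exists c, p = (c *v x0, c * vnorm x0)) -> A p).
        { intros p [Hp|[c ->]]; auto. }
        split; [|split; [|split]]; intros.
        * left. apply Aadd; apply E; trivial.
        * left. apply Ascal, E; trivial.
        * apply Ale, E; trivial.
        * left; trivial.
      + assert (E : forall p, (A p \/ exists c, p = (c *v x0, c * vnorm x0)) ->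
          exists c, p = (c *v x0, c * vnorm x0)).
        { intros p [Hp|Hp]; trivial. destruct Hempty; eauto. }
        split; [|split; [|split]].
        * intros x a y b H1 H2. apply E in H1 as [c H1]. apply E in H2 as [d H2].
          injection H1 as -> ->. injection H2 as -> ->.
          right. exists (c + d). f_equal; [vec|ring].
        * intros d x a H1. apply E in H1 as [c H1]. injection H1 as -> ->.
          right. exists (d * c). f_equal; [vec|ring].
        * intros x a H1. apply E in H1 as [c H1]. injection H1 as -> ->.
          rewrite vnorm_scal. apply Rmult_le_compat_r; [apply norm_ge0|apply Rle_abs].
        * intros _ _. right. exists 1. f_equal; [vec|ring].
    - auto.
    - right. exists 1. f_equal; [vec|ring]. }
  pose proof (maximal_graph_total x0 A HA A0 Hmax) as Htot.
  destruct HA as [Aadd [Ascal [Ale _]]].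
  assert (Huniq : forall x a b, A (x, a) -> A (x, b) -> a = b).
  { assert (L : forall x a b, A (x, a) -> A (x, b) -> a <= b).
    { intros x a b Ha Hb. apply (Ascal (-1)) in Hb.
      pose proof (Ale _ _ (Aadd _ _ _ _ Ha Hb)) as H.
      replace (x +v (-1) *v x) with (@vzero X) in H by vec. rewrite norm_zero in H. lra. }
    intros x a b Ha Hb. apply Rle_antisym; eapply L; eassumption. }
  set (f := fun x => proj1_sig (constructive_indefinite_description _ (Htot x))).
  assert (Hf : forall x, A (x, f x)).
  { intros x. unfold f. destruct constructive_indefinite_description; trivial. }
  clearbody f. exists f.
  assert (Lf : lin_functional f).
  { split.
    - intros x y. apply (Huniq (x +v y)); auto.
    - intros a x. apply (Huniq (a *v x)); auto. }
  split; [split; trivial|].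
  - intros x. apply Rabs_le. pose proof (Ale _ _ (Hf x)).
    pose proof (Ale _ _ (Hf (vopp x))) as H1. rewrite norm_opp, (lin_opp _ _ Lf) in H1. lra.
  - apply (Huniq x0); auto.
Qed.

(** * The dual space *)

Definition bounded_functional {X : Banach} (f : X -> R) : Prop :=
  lin_functional f /\ exists K, forall x, Rabs (f x) <= K * vnorm x.

Definition dual_car (X : Banach) : Type := {f : X -> R | bounded_functional f}.

Definition dfun {X : Banach} (f : dual_car X) : X -> R := proj1_sig f.

Lemma dual_car_ext {X : Banach} (f g : dual_car X) :
  (forall x, dfun f x = dfun g x) -> f = g.
Proof.
  destruct f as [f Hf], g as [g Hg]. simpl. intros E. apply functional_extensionality in E.
  apply subset_eq_compat. exact E.
Qed.

Lemma dual_norm_exists {X : Banach} (f : X -> R) :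
  bounded_functional f -> {r | dual_norm_is f r}.
Proof.
  intros Hf. apply completeness.
  - destruct Hf as [Lf [K HK]]. exists (Rabs K). intros s [x [Hx ->]].
    eapply Rle_trans; [apply HK|]. unfold ball in Hx.
    pose proof (Rle_abs K). pose proof (norm_ge0 x). pose proof (Rabs_pos K). nra.
  - exists (Rabs (f vzero)), vzero. split; trivial. unfold ball. rewrite norm_zero. lra.
Qed.

Definition dual_norm {X : Banach} (f : dual_car X) : R :=
  proj1_sig (dual_norm_exists (dfun f) (proj2_sig f)).

Lemma dual_norm_spec {X : Banach} (f : dual_car X) : dual_norm_is (dfun f) (dual_norm f).
Proof. unfold dual_norm. destruct dual_norm_exists; trivial. Qed.

Lemma dfun_lin {X : Banach} (f : dual_car X) : lin_functional (dfun f).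
Proof. apply (proj2_sig f). Qed.

Lemma dual_norm_bound {X : Banach} (f : dual_car X) x :
  Rabs (dfun f x) <= dual_norm f * vnorm x.
Proof. apply dual_norm_is_bound; [apply dfun_lin|apply dual_norm_spec]. Qed.

Lemma dual_norm_le {X : Banach} (f : dual_car X) c :
  0 <= c -> (forall x, Rabs (dfun f x) <= c * vnorm x) -> dual_norm f <= c.
Proof.
  intros Hc H. apply (dual_norm_spec f). intros s [x [Hx ->]].
  eapply Rle_trans; [apply H|]. unfold ball in Hx. nra.
Qed.

Lemma dual_norm_ge0 {X : Banach} (f : dual_car X) : 0 <= dual_norm f.
Proof.
  apply Rle_trans with (Rabs (dfun f vzero)); [apply Rabs_pos|].
  apply (dual_norm_spec f). exists vzero. split; trivial. unfold ball. rewrite norm_zero. lra.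
Qed.

Definition dual_zero (X : Banach) : dual_car X.
Proof.
  exists (fun _ => 0). split; [split; intros; ring|].
  exists 0. intros x. rewrite Rabs_R0. lra.
Defined.

Definition dual_add {X : Banach} (f g : dual_car X) : dual_car X.
Proof.
  exists (fun x => dfun f x + dfun g x).
  pose proof (dfun_lin f) as Lf. pose proof (dfun_lin g) as Lg. split.
  - split; intros; lin Lf; lin Lg; ring.
  - exists (dual_norm f + dual_norm g). intros x. eapply Rle_trans; [apply Rabs_triang|].
    pose proof (dual_norm_bound f x). pose proof (dual_norm_bound g x). lra.
Defined.

Definition dual_scal {X : Banach} (a : R) (f : dual_car X) : dual_car X.
Proof.
  exists (fun x => a * dfun f x). pose proof (dfun_lin f) as Lf. split.
  - split; intros; lin Lf; ring.
  - exists (Rabs a * dual_norm f). intros x. rewrite Rabs_mult, Rmult_assoc.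
    apply Rmult_le_compat_l; [apply Rabs_pos|apply dual_norm_bound].
Defined.

Lemma dual_norm_triangle {X : Banach} (f g : dual_car X) :
  dual_norm (dual_add f g) <= dual_norm f + dual_norm g.
Proof.
  apply dual_norm_le.
  - pose proof (dual_norm_ge0 f). pose proof (dual_norm_ge0 g). lra.
  - intros x. eapply Rle_trans; [apply Rabs_triang|].
    pose proof (dual_norm_bound f x). pose proof (dual_norm_bound g x). lra.
Qed.

Lemma dual_norm_scal {X : Banach} a (f : dual_car X) :
  dual_norm (dual_scal a f) = Rabs a * dual_norm f.
Proof.
  assert (L : forall b (g : dual_car X), dual_norm (dual_scal b g) <= Rabs b * dual_norm g).
  { intros b g. apply dual_norm_le.
    - apply Rmult_le_pos; [apply Rabs_pos|apply dual_norm_ge0].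
    - intros x. simpl. rewrite Rabs_mult, Rmult_assoc.
      apply Rmult_le_compat_l; [apply Rabs_pos|apply dual_norm_bound]. }
  apply Rle_antisym; trivial.
  destruct (Req_dec a 0) as [->|Ha].
  { rewrite Rabs_R0, Rmult_0_l. apply dual_norm_ge0. }
  specialize (L (/ a) (dual_scal a f)).
  replace (dual_scal (/ a) (dual_scal a f)) with f in L
    by (apply dual_car_ext; intros x; simpl; field; trivial).
  rewrite Rabs_inv in L. apply Rabs_pos_lt in Ha.
  apply (Rmult_le_compat_l (Rabs a)) in L; [|lra].
  replace (Rabs a * (/ Rabs a * dual_norm (dual_scal a f)))
    with (dual_norm (dual_scal a f)) in L by (field; lra). trivial.
Qed.

Lemma dual_norm_eq0 {X : Banach} (f : dual_car X) : dual_norm f = 0 -> f = dual_zero X.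
Proof.
  intros E. apply dual_car_ext. intros x. simpl.
  pose proof (dual_norm_bound f x) as H. rewrite E, Rmult_0_l in H.
  apply Rabs_le_inv in H. lra.
Qed.

Lemma dual_complete {X : Banach} (s : nat -> dual_car X) :
  (forall eps, eps > 0 -> exists N, forall m n, (m >= N)%nat -> (n >= N)%nat ->
    dual_norm (dual_add (s m) (dual_scal (-1) (s n))) < eps) ->
  exists l, forall eps, eps > 0 -> exists N, forall n, (n >= N)%nat ->
    dual_norm (dual_add (s n) (dual_scal (-1) l)) < eps.
Proof.
  intros Hs.
  assert (Hb : forall m n x, Rabs (dfun (s m) x - dfun (s n) x) <=
    dual_norm (dual_add (s m) (dual_scal (-1) (s n))) * vnorm x).
  { intros m n x. replace (dfun (s m) x - dfun (s n) x)
      with (dfun (dual_add (s m) (dual_scal (-1) (s n))) x) by (simpl; ring).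
    apply dual_norm_bound. }
  assert (Hc : forall x, {l | Un_cv (fun n => dfun (s n) x) l}).
  { intros x. apply R_complete. intros eps He.
    assert (Hp : 0 < vnorm x + 1) by (pose proof (norm_ge0 x); lra).
    destruct (Hs (eps / (vnorm x + 1))) as [N HN]; [apply Rdiv_lt_0_compat; lra|].
    exists N. intros m n Hm Hn. unfold R_dist.
    eapply Rle_lt_trans; [apply Hb|]. specialize (HN m n Hm Hn).
    pose proof (dual_norm_ge0 (dual_add (s m) (dual_scal (-1) (s n)))).
    apply (Rmult_lt_compat_r (vnorm x + 1)) in HN; trivial.
    replace (eps / (vnorm x + 1) * (vnorm x + 1)) with eps in HN by (field; lra). lra. }
  set (g := fun x => proj1_sig (Hc x)).
  assert (Hg : forall x, Un_cv (fun n => dfun (s n) x) (g x)).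
  { intros x. unfold g. destruct (Hc x); trivial. }
  clearbody g.
  assert (Lg : lin_functional g).
  { split.
    - intros x y. apply (UL_sequence (fun n => dfun (s n) (x +v y))); trivial.
      apply Un_cv_ext_eq with (fun n => dfun (s n) x + dfun (s n) y).
      { intros n. symmetry. apply lin_add, dfun_lin. }
      apply CV_plus; trivial.
    - intros a x. apply (UL_sequence (fun n => dfun (s n) (a *v x))); trivial.
      apply Un_cv_ext_eq with (fun n => a * dfun (s n) x).
      { intros n. symmetry. apply lin_scal, dfun_lin. }
      apply CV_mult; trivial. apply Un_cv_const. }
  assert (Hlim : forall eps, eps > 0 -> exists N, forall n, (n >= N)%nat ->
    forall x, Rabs (dfun (s n) x - g x) <= eps * vnorm x).
  { intros eps He. destruct (Hs eps He) as [N HN]. exists N. intros n Hn x.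
    apply Rnot_lt_le; intros Hlt.
    destruct (Hg x (Rabs (dfun (s n) x - g x) - eps * vnorm x)) as [M HM]; [lra|].
    specialize (HM (max N M) (Nat.le_max_r N M)). unfold R_dist in HM.
    specialize (HN n (max N M) Hn (Nat.le_max_l N M)).
    pose proof (Hb n (max N M) x) as H1. pose proof (norm_ge0 x).
    assert (H2 : dual_norm (dual_add (s n) (dual_scal (-1) (s (max N M)))) * vnorm x
      <= eps * vnorm x) by (apply Rmult_le_compat_r; lra).
    pose proof (Rabs_triang (dfun (s n) x - dfun (s (max N M)) x)
      (dfun (s (max N M)) x - g x)) as T.
    replace (dfun (s n) x - dfun (s (max N M)) x + (dfun (s (max N M)) x - g x))
      with (dfun (s n) x - g x) in T by ring. lra. }
  assert (Bg : bounded_functional g).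
  { split; trivial. destruct (Hlim 1) as [N HN]; [lra|].
    exists (dual_norm (s N) + 1). intros x. specialize (HN N (le_n N) x).
    pose proof (dual_norm_bound (s N) x) as H. rewrite Rabs_minus_sym in HN.
    pose proof (Rabs_triang (dfun (s N) x) (g x - dfun (s N) x)) as T.
    replace (dfun (s N) x + (g x - dfun (s N) x)) with (g x) in T by ring. lra. }
  exists (exist _ g Bg). intros eps He. destruct (Hlim (eps / 2)) as [N HN]; [lra|].
  exists N. intros n Hn. apply Rle_lt_trans with (eps / 2); [|lra].
  apply dual_norm_le; [lra|]. intros x. simpl.
  replace (dfun (s n) x + -1 * g x) with (dfun (s n) x - g x) by ring. auto.
Qed.

(** Kept transparent: later steps identify its norm and operations with those on [dual_car] by
    conversion. *)
Definition dual (X : Banach) : Banach.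
Proof.
  refine (mkBanach (dual_car X) (dual_zero X) dual_add (dual_scal (-1)) dual_scal dual_norm
    _ _ _ _ _ _ _ _ dual_norm_eq0 dual_norm_scal dual_norm_triangle dual_complete);
  intros; apply dual_car_ext; intros; simpl; ring.
Defined.

Definition dual_comp {X : Banach} (S : X -> X) (HS : lin_isometry S) (f : dual X) : dual X.
Proof.
  exists (fun x => dfun f (S x)). destruct HS as [[S1 S2] NS].
  pose proof (dfun_lin f) as Lf. split; [split|].
  - intros x y. rewrite S1. apply Lf.
  - intros a x. rewrite S2. apply Lf.
  - exists (dual_norm f). intros x. rewrite <- NS. apply dual_norm_bound.
Defined.

Lemma dual_comp_inverse {X : Banach} (T S : X -> X)
  (HT : lin_isometry T) (HS : lin_isometry S) :
  inverse_isometries T S -> inverse_isometries (dual_comp S HS) (dual_comp T HT).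
Proof.
  intros [_ [_ [TS ST]]].
  assert (N : forall (A : X -> X) (HA : lin_isometry A) (f : dual X),
    vnorm (dual_comp A HA f) <= vnorm f).
  { intros A HA f. apply dual_norm_le; [apply dual_norm_ge0|].
    intros x. simpl. rewrite <- (proj2 HA x). apply dual_norm_bound. }
  assert (C1 : forall f, dual_comp S HS (dual_comp T HT f) = f).
  { intros f. apply dual_car_ext; intros x; simpl. rewrite TS; trivial. }
  assert (C2 : forall f, dual_comp T HT (dual_comp S HS f) = f).
  { intros f. apply dual_car_ext; intros x; simpl. rewrite ST; trivial. }
  repeat split; trivial; intros; try (apply dual_car_ext; intros; reflexivity).
  - apply Rle_antisym; trivial. rewrite <- (C2 x) at 1. trivial.
  - apply Rle_antisym; trivial. rewrite <- (C1 x) at 1. trivial.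
Qed.

Lemma dual_ball_bounded {X : Banach} (f : X -> R) : dual_ball f -> bounded_functional f.
Proof.
  intros [Lf Bf]. split; trivial. exists 1. intros x. rewrite Rmult_1_l; trivial.
Qed.

Definition to_dual {X : Banach} (f : X -> R) (Hf : dual_ball f) : dual X :=
  exist _ f (dual_ball_bounded f Hf).

Lemma dual_add_apply {X : Banach} (f g : dual X) x : dfun (f +v g) x = dfun f x + dfun g x.
Proof. reflexivity. Qed.

Lemma dual_scal_apply {X : Banach} a (f : dual X) x : dfun (a *v f) x = a * dfun f x.
Proof. reflexivity. Qed.

Lemma dual_sub_apply {X : Banach} (f g : dual X) x : dfun (f -v g) x = dfun f x - dfun g x.
Proof. simpl. ring. Qed.

Lemma eval_lin {X : Banach} (x : X) : lin_functional (fun f : dual X => dfun f x).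
Proof. split; intros; reflexivity. Qed.

(** The contraction [g - g(v) f] is the adjoint of [x - f(x) v], so the roles of point and
    functional are exchanged. *)
Lemma bicontractive_at_dual {X : Banach} (v : X) (f : X -> R) (Hf : bicontractive_at v f) :
  vnorm v = 1 ->
  bicontractive_at (to_dual f (proj1 Hf)) (fun g : dual X => dfun g v).
Proof.
  intros Hv. split; [split|split].
  - apply eval_lin.
  - intros g. pose proof (dual_norm_bound g v) as H. rewrite Hv, Rmult_1_r in H. trivial.
  - apply (proj2 Hf).
  - intros g. apply dual_norm_le; [apply dual_norm_ge0|]. intros x.
    rewrite dual_sub_apply, dual_scal_apply. simpl.
    replace (dfun g x - dfun g v * f x) with (dfun g (x -v f x *v v))
      by (lin (dfun_lin g); ring).
    eapply Rle_trans; [apply dual_norm_bound|].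
    apply Rmult_le_compat_l; [apply dual_norm_ge0|apply (proj2 Hf)].
Qed.

Lemma dual_attained {X : Banach} (g : dual X) (v : X) :
  vnorm v = 1 -> dfun g v <= vnorm g.
Proof.
  intros Hv. pose proof (dual_norm_bound g v) as H. rewrite Hv, Rmult_1_r in H.
  apply Rle_trans with (2 := H). apply Rle_abs.
Qed.

Lemma bicontractive_norm {X : Banach} (v : X) (f : X -> R) (Hf : bicontractive_at v f) :
  vnorm v = 1 -> vnorm (to_dual f (proj1 Hf)) = 1.
Proof.
  intros Hv. apply Rle_antisym.
  - apply dual_norm_le; [lra|]. intros x. rewrite Rmult_1_l. apply (proj1 Hf).
  - pose proof (dual_attained (to_dual f (proj1 Hf)) v Hv) as H.
    change (f v <= vnorm (to_dual f (proj1 Hf))) in H.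
    apply Rle_trans with (2 := H). right. symmetry. apply Hf.
Qed.

Lemma dual_unit_sphere {X : Banach} (g : dual X) : vnorm g = 1 -> dual_sphere (dfun g).
Proof. intros Hg. split; [apply dfun_lin|]. rewrite <- Hg. apply dual_norm_spec. Qed.

Lemma dual_unit_ball {X : Banach} (g : dual X) : vnorm g <= 1 -> dual_ball (dfun g).
Proof.
  intros Hg. split; [apply dfun_lin|]. intros x.
  eapply Rle_trans; [apply dual_norm_bound|]. change (dual_norm g) with (vnorm g).
  pose proof (norm_ge0 x). nra.
Qed.

Lemma LUR_converges {X : Banach} (g : dual X) (fs : nat -> dual X) :
  dual_wstar_LUR X -> vnorm g = 1 -> (forall n, vnorm (fs n) <= 1) ->
  Un_cv (fun n => vnorm (g +v fs n)) 2 ->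
  forall x, Un_cv (fun n => dfun (fs n) x) (dfun g x).
Proof.
  intros HL Hg Hfs Hcv.
  apply (HL (dfun g) (fun n => dfun (fs n)) (dual_unit_sphere g Hg)
    (fun n => dual_unit_ball (fs n) (Hfs n)) (fun n => vnorm (g +v fs n))); trivial.
  intros n. apply (dual_norm_spec (g +v fs n)).
Qed.

(** The LUR property is applied to a constant sequence. *)
Lemma LUR_strictly_convex (X : Banach) : dual_wstar_LUR X -> strictly_convex (dual X).
Proof.
  intros HL g h Hg Hh E. apply dual_car_ext. intros x.
  apply (UL_sequence (fun _ => dfun h x)); [|apply Un_cv_const].
  apply (LUR_converges g (fun _ => h)); trivial.
  - intros _. lra.
  - rewrite E. apply Un_cv_const.
Qed.

Lemma dual_almost_norming {X : Banach} (g : dual X) c :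
  c < vnorm g -> exists x, ball X x /\ c < dfun g x.
Proof.
  intros Hc. apply NNPP; intros HN. assert (vnorm g <= c); [|lra].
  apply (dual_norm_spec g). intros s [x [Hx ->]].
  assert (Q : forall z, ball X z -> dfun g z <= c).
  { intros z Hz. apply Rnot_lt_le; intros Hlt. apply HN. exists z; auto. }
  assert (Hx' : ball X (vopp x)) by (unfold ball; rewrite norm_opp; trivial).
  pose proof (Q _ Hx) as Q1. pose proof (Q _ Hx') as Q2.
  rewrite (lin_opp _ _ (dfun_lin g)) in Q2. apply Rabs_le. lra.
Qed.

Lemma LUR_orbit_converges {X : Banach} (u : X) (f : X -> R) (Hf : bicontractive_at u f) (g : dual X) :
  big_point u -> dual_wstar_LUR X -> vnorm g = 1 ->
  exists T S : nat -> X -> X, (forall n, inverse_isometries (T n) (S n)) /\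
    Un_cv (fun n => dfun g (T n u)) 1 /\
    forall x, Un_cv (fun n => f (S n x)) (dfun g x).
Proof.
  intros Hbig HL Hg.
  assert (Hu : vnorm u = 1) by apply Hbig.
  assert (H : forall n, exists TS : (X -> X) * (X -> X),
    inverse_isometries (fst TS) (snd TS) /\ 1 - / (INR n + 1) < dfun g (fst TS u)).
  { intros n. assert (Hn : 0 < / (INR n + 1)).
    { apply Rinv_0_lt_compat. pose proof (pos_INR n). lra. }
    destruct (dual_almost_norming g (1 - / (INR n + 1))) as [x [Hx Hgx]]; [lra|].
    destruct (big_point_functional u (dfun g) 1 (1 - / (INR n + 1)) x Hbig (dfun_lin g))
      as [T [HT HgT]]; trivial.
    { intros y. apply Rle_trans with (1 := Rle_abs _). rewrite <- Hg. apply dual_norm_bound. }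
    destruct (surj_lin_isometry_inverse T HT) as [S HTS]. exists (T, S); auto. }
  set (TS := fun n => proj1_sig (constructive_indefinite_description _ (H n))).
  assert (HTS : forall n, inverse_isometries (fst (TS n)) (snd (TS n)) /\
    1 - / (INR n + 1) < dfun g (fst (TS n) u)).
  { intros n. unfold TS. destruct constructive_indefinite_description; trivial. }
  clearbody TS. clear H.
  assert (Hv : forall n, vnorm (fst (TS n) u) = 1).
  { intros n. rewrite (proj2 (proj1 (proj1 (HTS n)))); trivial. }
  assert (Hb : forall n, bicontractive_at (fst (TS n) u) (fun x => f (snd (TS n) x))).
  { intros n. apply bicontractive_at_orbit; trivial. apply HTS. }
  exists (fun n => fst (TS n)), (fun n => snd (TS n)).
  split; [intros n; apply HTS|split].
  - intros e He. destruct (inv_succ_small e He) as [N HN]. exists N. intros n Hn.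
    specialize (HN n Hn). destruct (HTS n) as [_ H]. unfold R_dist.
    pose proof (dual_attained g _ (Hv n)) as H1. rewrite Hg in H1.
    rewrite Rabs_minus_sym, Rabs_right; lra.
  - apply (LUR_converges g (fun n => to_dual _ (proj1 (Hb n)))); trivial.
    + intros n. right. exact (bicontractive_norm _ _ (Hb n) (Hv n)).
    (* The sum is evaluated at [T n u], where the orbit functional equals 1 and [g] exceeds
       [1 - 1/(n+1)]. *)
    + intros e He. destruct (inv_succ_small e He) as [N HN]. exists N. intros n Hn.
      specialize (HN n Hn). destruct (HTS n) as [_ H]. unfold R_dist.
      set (k := to_dual _ (proj1 (Hb n))).
      pose proof (dual_attained (g +v k) _ (Hv n)) as H1.
      rewrite dual_add_apply in H1.
      assert (Ek : dfun k (fst (TS n) u) = 1) by apply (Hb n).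
      assert (Nk : vnorm k = 1) by (apply bicontractive_norm; trivial).
      pose proof (vnorm_triangle _ g k) as T.
      rewrite Rabs_minus_sym, Rabs_right; lra.
Qed.

Lemma dual_hilbert_of_LUR {X : Banach} (u : X) (f : X -> R) :
  big_point u -> bicontractive_at u f -> dual_wstar_LUR X -> is_hilbert (dual X).
Proof.
  intros Hbig Hf HL. assert (Hu : vnorm u = 1) by apply Hbig.
  pose proof (LUR_strictly_convex X HL) as SC.
  apply (hilbert_of_bicontractive (to_dual f (proj1 Hf)) (fun g => dfun g u)); trivial.
  - apply bicontractive_norm; trivial.
  - apply bicontractive_at_dual; trivial.
  - intros g Hg.
    destruct (LUR_orbit_converges u f Hf g Hbig HL Hg) as [T [S [HTS [Hcu Hcv]]]].
    assert (Hv : forall n, vnorm (T n u) = 1).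
    { intros n. rewrite (proj2 (proj1 (HTS n))); trivial. }
    assert (Hb : forall n, bicontractive_at (T n u) (fun x => f (S n x))).
    { intros n. apply bicontractive_at_orbit; trivial. }
    set (k := fun n => to_dual _ (proj1 (Hb n))).
    assert (Hk : forall n, bicontractive_at (k n) (fun g : dual X => dfun g (T n u))).
    { intros n. exact (bicontractive_at_dual _ _ (Hb n) (Hv n)). }
    apply (bicontractive_limit g k (fun n g => dfun g (T n u))); trivial;
      try (intros n; apply Hk).
    (* Lower semicontinuity of the dual norm under pointwise convergence: the limit is tested at one
       almost norming vector [x]. *)
    intros h s e He.
    destruct (dual_almost_norming (h -v s *v g) (vnorm (h -v s *v g) - e / 2))
      as [x [Hx Hhx]]; [lra|].
    destruct (Hcv x (e / 2 / (Rabs s + 1))) as [N HN].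
    { apply Rdiv_lt_0_compat; [lra|]. pose proof (Rabs_pos s); lra. }
    exists N. intros n Hn. specialize (HN n Hn). unfold R_dist in HN.
    pose proof (dual_norm_bound (h -v s *v k n) x) as H1.
    pose proof (Rle_trans _ _ _ (Rle_abs _) H1) as H2.
    rewrite dual_sub_apply, dual_scal_apply in H2, Hhx.
    change (dfun (k n) x) with (f (S n x)) in H2.
    change (dual_norm (h -v s *v k n)) with (vnorm (h -v s *v k n)) in H2.
    assert (H3 : vnorm (h -v s *v k n) * vnorm x <= vnorm (h -v s *v k n)).
    { rewrite <- (Rmult_1_r (vnorm (h -v s *v k n))) at 2.
      apply Rmult_le_compat_l; [apply norm_ge0|exact Hx]. }
    assert (H4 : Rabs (s * (f (S n x) - dfun g x)) <= e / 2).
    { rewrite Rabs_mult. pose proof (Rabs_pos s) as Ps.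
      apply (Rmult_lt_compat_r (Rabs s + 1)) in HN; [|lra].
      replace (e / 2 / (Rabs s + 1) * (Rabs s + 1)) with (e / 2) in HN by (field; lra).
      pose proof (Rabs_pos (f (S n x) - dfun g x)). nra. }
    apply Rabs_le_inv in H4. lra.
  - intros [h [Hhu [Hh Hspan]]] g Hg eps He.
    destruct (LUR_orbit_converges u f Hf g Hbig HL Hg) as [T [S [HTS [_ Hcv]]]].
    (* In a plane pointwise convergence is norm convergence: since [h] vanishes at [u], the values
       at [u] and at [x0] determine the coordinates in the basis [e], [h], and both differences tend
       to 0. *)
    assert (Hx0 : exists x0, dfun h x0 <> 0).
    { apply NNPP; intros HN. apply Hh. apply dual_car_ext. intros x. simpl.
      apply NNPP; intros Hx. apply HN. exists x; trivial. }
    destruct Hx0 as [x0 Hx0].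
    set (e := to_dual f (proj1 Hf)) in *.
    set (a := fun n => dfun g u - f (S n u)).
    set (b := fun n => (dfun g x0 - f (S n x0) - a n * f x0) / dfun h x0).
    assert (Ha : Un_cv a 0).
    { replace 0 with (dfun g u - dfun g u) by ring.
      apply CV_minus; [apply Un_cv_const|apply Hcv]. }
    assert (Hb : Un_cv b 0).
    { unfold b, Rdiv. replace 0 with ((dfun g x0 - dfun g x0 - 0 * f x0) * / dfun h x0) by ring.
      apply CV_mult; [|apply Un_cv_const].
      apply CV_minus; [|apply CV_mult; [trivial|apply Un_cv_const]].
      apply CV_minus; [apply Un_cv_const|apply Hcv]. }
    assert (Hp : 0 < vnorm h + 1) by (pose proof (norm_ge0 h); lra).
    destruct (Ha (eps / 2)) as [N1 H1]; [lra|].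
    destruct (Hb (eps / 2 / (vnorm h + 1))) as [N2 H2]; [apply Rdiv_lt_0_compat; lra|].
    set (n := max N1 N2).
    specialize (H1 n (Nat.le_max_l _ _)). specialize (H2 n (Nat.le_max_r _ _)).
    unfold R_dist in H1, H2. rewrite Rminus_0_r in H1, H2.
    pose proof (HTS n) as [HT [HS _]].
    exists (dual_comp (S n) HS), (dual_comp (T n) HT).
    split; [apply dual_comp_inverse, HTS|].
    set (k := dual_comp (S n) HS e).
    destruct (Hspan (g -v k)) as [c [d Ecd]].
    assert (Kx : forall x, dfun g x - f (S n x) = c * f x + d * dfun h x).
    { intros x. pose proof (f_equal (fun l : dual X => dfun l x) Ecd) as E. cbv beta in E.
      rewrite dual_sub_apply in E. exact E. }
    assert (Ec : c = a n).
    { unfold a. rewrite Kx, Hhu. rewrite (proj1 (proj2 Hf)). ring. }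
    assert (Ed : d = b n).
    { unfold b. rewrite Kx, <- Ec. field; trivial. }
    assert (Ne : vnorm e = 1) by exact (bicontractive_norm _ _ Hf Hu).
    change (vnorm (g -v k) < eps). rewrite Ecd, Ec, Ed.
    eapply Rle_lt_trans; [apply vnorm_triangle|]. rewrite !vnorm_scal, Ne.
    apply (Rmult_lt_compat_r (vnorm h + 1)) in H2; trivial.
    replace (eps / 2 / (vnorm h + 1) * (vnorm h + 1)) with (eps / 2) in H2 by (field; lra).
    pose proof (Rabs_pos (b n)). lra.
Qed.

(** * Return from the dual to the space *)

Lemma hilbert_parallelogram (X : Banach) : is_hilbert X ->
  forall x y : X, vnorm (x +v y) ^ 2 + vnorm (x -v y) ^ 2 = 2 * (vnorm x ^ 2 + vnorm y ^ 2).
Proof.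
  intros [ip [Hadd [Hscal [Hsym [Hpos Hn]]]]] x y.
  rewrite !Hn, !pow2_sqrt by trivial. unfold vsub. rewrite vopp_scal.
  assert (Haddr : forall a b c, ip a (b +v c) = ip a b + ip a c).
  { intros a b c. rewrite Hsym, Hadd, (Hsym b), (Hsym c). trivial. }
  assert (Hscalr : forall r a b, ip a (r *v b) = r * ip a b).
  { intros r a b. rewrite Hsym, Hscal, (Hsym b). trivial. }
  rewrite !Hadd, !Haddr, !Hscal, !Hscalr, (Hsym y x). ring.
Qed.

(** Take norming functionals of [x + y] and [x - y] scaled by [p] and [q]. Then
    [p^2 + q^2 = (G + H)(x) + (G - H)(y)], and [A m <= A^2/4 + m^2], its analogue for [B], and the
    parallelogram law in the dual give the inequality. *)
Lemma predual_parallelogram (X : Banach) : is_hilbert (dual X) ->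
  forall x y : X, vnorm (x +v y) ^ 2 + vnorm (x -v y) ^ 2 <= 2 * (vnorm x ^ 2 + vnorm y ^ 2).
Proof.
  intros HX x y.
  destruct (norming_functional (x +v y)) as [g [Hg Eg]].
  destruct (norming_functional (x -v y)) as [h [Hh Eh]].
  set (p := vnorm (x +v y)) in *. set (q := vnorm (x -v y)) in *.
  set (G := p *v to_dual g Hg : dual X). set (H := q *v to_dual h Hh : dual X).
  assert (NG : forall k (Hk : dual_ball k) c, 0 <= c -> vnorm (c *v to_dual k Hk : dual X) <= c).
  { intros k Hk c Hc. rewrite vnorm_scal, Rabs_right by lra.
    assert (vnorm (to_dual k Hk : dual X) <= 1); [|nra].
    apply dual_norm_le; [lra|]. intros z. rewrite Rmult_1_l. apply Hk. }
  assert (Hp : 0 <= p) by apply norm_ge0. assert (Hq : 0 <= q) by apply norm_ge0.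
  pose proof (NG g Hg p Hp) as NGG. fold G in NGG.
  pose proof (NG h Hh q Hq) as NHH. fold H in NHH.
  pose proof (norm_ge0 G) as G0. pose proof (norm_ge0 H) as H0.
  pose proof (hilbert_parallelogram _ HX G H) as Par.
  pose proof (dual_norm_bound (G +v H) x) as B1. pose proof (dual_norm_bound (G -v H) y) as B2.
  apply Rabs_le_inv in B1. apply Rabs_le_inv in B2.
  rewrite dual_add_apply in B1. rewrite dual_sub_apply in B2.
  unfold G at 2 in B1. unfold H at 2 in B1. unfold G at 2 in B2. unfold H at 2 in B2.
  rewrite !dual_scal_apply in B1, B2. simpl dfun in B1, B2.
  change (@dual_norm X) with (@vnorm (dual X)) in B1, B2.
  rewrite (lin_add _ _ _ (proj1 Hg)) in Eg. rewrite (lin_sub _ _ _ (proj1 Hh)) in Eh.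
  set (A := vnorm (G +v H)) in *. set (B := vnorm (G -v H)) in *.
  set (m := vnorm x) in *. set (n := vnorm y) in *.
  assert (E : p ^ 2 + q ^ 2 <= A * m + B * n).
  { replace (p ^ 2) with (p * (g x + g y)) by (rewrite Eg; ring).
    replace (q ^ 2) with (q * (h x - h y)) by (rewrite Eh; ring). lra. }
  assert (P : A ^ 2 + B ^ 2 <= 2 * (p ^ 2 + q ^ 2)) by nra.
  pose proof (pow2_ge_0 (A - 2 * m)). pose proof (pow2_ge_0 (B - 2 * n)). nra.
Qed.

Lemma hilbert_of_dual_hilbert {X : Banach} (u : X) (f : X -> R) :
  big_point u -> bicontractive_at u f -> is_hilbert (dual X) -> is_hilbert X.
Proof.
  intros Hbig Hf HX. assert (Hu : vnorm u = 1) by apply Hbig.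
  pose proof (predual_parallelogram X HX) as Par.
  apply (hilbert_of_dense_orbit u f); trivial.
  - intros x y Hx Hy Hxy. apply vsub_eq0, vnorm_eq0.
    specialize (Par x y). rewrite Hx, Hy, Hxy in Par.
    pose proof (norm_ge0 (x -v y)). nra.
  - intros x Hx eps He.
    (* The inequality bounds [||T u - x||^2] by [4 - ||T u + x||^2], which is below
       [4 - (2 - d)^2 < 4 d <= eps^2]; [d <= 1] keeps [2 - d] positive for squaring. *)
    set (d := Rmin 1 (eps ^ 2 / 4)).
    assert (Hd : 0 < d /\ d <= 1 /\ d <= eps ^ 2 / 4).
    { unfold d. split; [apply Rmin_glb_lt; nra|split; [apply Rmin_l|apply Rmin_r]]. }
    clearbody d.
    destruct (big_point_add u x d Hbig Hx) as [T [HT Hn]]; [tauto|].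
    destruct (surj_lin_isometry_inverse T HT) as [S HTS]. exists T, S. split; trivial.
    specialize (Par (T u) x). rewrite (proj1 (proj2 HT)), Hu, Hx in Par.
    rewrite norm_sub_sym. apply Rnot_le_lt; intros Hle. nra.
Qed.

Theorem theorem3p2 (X : Banach) (u : X) (P : X -> X) :
  big_point u ->
  projection_onto_span P u ->
  bicontractive P ->
  (cond_a u P \/ dual_wstar_LUR X) ->
  is_hilbert X.
Proof.
  intros Hbig HP HC Hcond. assert (Hu : vnorm u = 1) by apply Hbig.
  destruct (projection_functional u P Hu HP HC) as [f [Hf Pf]].
  assert (Hb : dual_wstar_LUR X -> is_hilbert X).
  { intros HL. apply (hilbert_of_dual_hilbert u f); trivial.
    apply (dual_hilbert_of_LUR u f); trivial. }
  destruct Hcond as [Ha|HL]; [|auto].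
  pose proof (cond_a_uniform u P f Hu Pf Ha) as Ha'.
  destruct (classic (forall eps, 0 < eps -> exists d, 0 < d /\ forall T, surj_lin_isometry T ->
    1 - d < f (T u) -> vnorm (T u -v u) < eps)) as [HI|HI].
  - apply (hilbert_of_strongly_exposed_orbit u f); trivial.
  - apply Hb, (dual_LUR_of_not_strongly_exposed u f); trivial.
Qed.
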